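(* Let $R$ be a ring and $C$ a left $R$-module. The following assertions hold. 1. If ${}_RC$ is self-small and $\Sigma$-self-orthogonal, then the triple $$\left(\mathrm{Add}_R(C),\ \mathrm{cores}(\widehat{\mathrm{Add}_R(C)}),\ \mathcal{B}_C(R)\right)$$ is a right weak AB-context in the category of left $R$-modules. In this case, for every $N\in\mathrm{cores}(\widehat{\mathcal{B}_C(R)})$ there exist exact sequences $0\to Y^N\to X^N\to N\to0$ and $0\to N\to Y_N\to X_N\to0$ with $Y_N,Y^N\in\mathcal{B}_C(R)$ and $X_N,X^N\in\mathrm{cores}(\widehat{\mathrm{Add}_R(C)})$. 2. If ${}_RC$ is self-co-small and $\prod$-$\mathrm{Tor}$-orthogonal, then the triple $$\left(\mathcal{A}_C(R),\ \mathrm{res}(\widehat{\mathrm{Prod}_R(C^+)}),\ \mathrm{Prod}_R(C^+)\right)$$ is a left weak AB-context in the category of right $R$-modules. In this case, for every $M\in\mathrm{res}(\widehat{\mathcal{A}_C(R)})$ there exist exact sequences of right $R$-modules $0\to Y_M\to X_M\to M\to0$ and $0\to M\to Y^M\to X^M\to0$ with $X_M,X^M\in\mathcal{A}_C(R)$ and $Y_M,Y^M\in\mathrm{res}(\widehat{\mathrm{Prod}_R(C^+)})$.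
   Context: Rings are associative with identity. $S=\mathrm{End}_R(C)$ acts on the right of $C$, so $C$ is an $(R,S)$-bimodule. $(-)^+=\mathrm{Hom}_{\mathbb Z}(-,\mathbb Q/\mathbb Z)$. $\mathrm{Add}_R(C)$ (resp. $\mathrm{Prod}_R(C^+)$) is the class of left (resp. right) $R$-modules isomorphic to direct summands of direct sums of copies of $C$ (resp. direct products of copies of $C^+$). $C$ is self-small if the canonical map between $\mathrm{Hom}_R(C,C)^{(I)}$ and $\mathrm{Hom}_R(C,C^{(I)})$ is an isomorphism for every set $I$; self-co-small if the canonical maps $(C^+)^I\otimes_RC\to(C^+\otimes_RC)^I$ and $C^+\otimes_RC\to\mathrm{Hom}_R(C,C)^+$ are isomorphisms for every set $I$; $\Sigma$-self-orthogonal if $\mathrm{Ext}_R^i(C,C^{(I)})=0$ for every set $I$ and $i\geq1$; $\prod$-$\mathrm{Tor}$-orthogonal if $\mathrm{Tor}^R_i((C^+)^I,C)=0$ for every set $I$ and $i\geq1$. $\mathcal{B}_C(R)$ is the class of left $R$-modules $N$ with $\mathrm{Ext}_R^{\geq1}(C,N)=0=\mathrm{Tor}^S_{\geq1}(C,\mathrm{Hom}_R(C,N))$ and canonical map $C\otimes_S\mathrm{Hom}_R(C,N)\to N$ an isomorphism. $\mathcal{A}_C(R)$ is the class of right $R$-modules $M$ with $\mathrm{Tor}^R_{\geq1}(M,C)=0=\mathrm{Ext}_S^{\geq1}(C,M\otimes_RC)$ and canonical map $M\to\mathrm{Hom}_S(C,M\otimes_RC)$ an isomorphism. For a class $\mathcal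 X$ of objects of an abelian category, $\mathrm{res}(\widehat{\mathcal X})$ is the class of objects $M$ having a finite $\mathcal X$-resolution $0\to X_n\to\cdots\to X_0\to M\to0$ (exact, $X_i\in\mathcal X$), and $\mathrm{cores}(\widehat{\mathcal X})$ the class of objects having a finite $\mathcal X$-coresolution $0\to M\to X^0\to\cdots\to X^n\to0$. A class is left (right) thick if closed under extensions, direct summands, and kernels of epimorphisms (cokernels of monomorphisms) between its objects. A triple $(\mathcal X,\mathcal Y,\omega)$ is a left weak AB-context if: $\mathcal X$ is left thick; $\mathcal Y$ is right thick and $\mathcal Y\subseteq\mathrm{res}(\widehat{\mathcal X})$; $\omega=\mathcal X\cap\mathcal Y$, $\mathrm{Ext}^{i}(X,W)=0$ for all $X\in\mathcal X$, $W\in\omega$, $i\geq1$, and every $X\in\mathcal X$ admits an exact sequence $0\to X\to W\to X'\to0$ with $W\in\omega$, $X'\in\mathcal X$. Dually, $(\omega,\mathcal X,\mathcal Y)$ is a right weak AB-context if: $\mathcal Y$ is right thick; $\mathcal X$ is left thick and $\mathcal X\subseteq\mathrm{cores}(\widehat{\mathcal Y})$; $\omega=\mathcal X\cap\mathcal Y$, $\mathrm{Ext}^i(W,Y)=0$ for all $W\in\omega$, $Y\in\mathcal Y$, $i\geq1$, and every $Y\in\mathcal Y$ admits an exact sequence $0\to Y'\to W\to Y\to0$ with $W\in\omega$, $Y'\in\mathcal Y$. *)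

(* Defs.v *)
From HB Require Import structures.
From mathcomp Require Import all_boot all_algebra finmap freeg.
From mathcomp Require Import boolp classical_sets functions cardinality.

Set Implicit Arguments.
Unset Strict Implicit.
Unset Printing Implicit Defensive.

Import GRing.Theory.
Local Open Scope ring_scope.
Local Open Scope quotient_scope.
Local Open Scope classical_set_scope.

(* Left R-modules are [lmodType R]; right R-modules are left modules over the
   converse ring, [lmodType R^c], the action [m r] being written [r *: m]. *)

Section AdditiveGroup.
Variables U V : zmodType.

HB.instance Definition _ := gen_eqMixin {additive U -> V}.
HB.instance Definition _ := gen_choiceMixin {additive U -> V}.

Lemma additive_ext (f g : {additive U -> V}) : f =1 g -> f = g.
Proof.
move: f g => [f [[f_add]]] [g [[g_add]]] /= /funext fg; subst g.
by rewrite (Prop_irrelevance f_add g_add).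
Qed.

Definition add_zero : {additive U -> V} := \0.
Definition add_plus (f g : {additive U -> V}) : {additive U -> V} := f \+ g.
Definition add_opp (f : {additive U -> V}) : {additive U -> V} := \- f.

Fact add_plusA : associative add_plus.
Proof. by move=> f g h; apply: additive_ext => x /=; rewrite addrA. Qed.
Fact add_plusC : commutative add_plus.
Proof. by move=> f g; apply: additive_ext => x /=; rewrite addrC. Qed.
Fact add_plus0 : left_id add_zero add_plus.
Proof. by move=> f; apply: additive_ext => x /=; rewrite add0r. Qed.
Fact add_plusN : left_inverse add_zero add_opp add_plus.
Proof. by move=> f; apply: additive_ext => x /=; rewrite addNr. Qed.

HB.instance Definition _ := GRing.isZmodule.Build {additive U -> V}
  add_plusA add_plusC add_plus0 add_plusN.

End AdditiveGroup.

Section LinearGroup.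
Variables (R : pzRingType) (U V : lmodType R).

HB.instance Definition _ := gen_eqMixin {linear U -> V}.
HB.instance Definition _ := gen_choiceMixin {linear U -> V}.

Lemma linear_ext (f g : {linear U -> V}) : f =1 g -> f = g.
Proof.
move: f g => [f [[f_add] [f_scale]]] [g [[g_add] [g_scale]]] /= /funext fg.
subst g; rewrite (Prop_irrelevance f_add g_add).
by rewrite (Prop_irrelevance f_scale g_scale).
Qed.

Definition lin_zero : {linear U -> V} := \0.
Definition lin_plus (f g : {linear U -> V}) : {linear U -> V} := f \+ g.
Definition lin_opp (f : {linear U -> V}) : {linear U -> V} := \- f.

Fact lin_plusA : associative lin_plus.
Proof. by move=> f g h; apply: linear_ext => x /=; rewrite addrA. Qed.
Fact lin_plusC : commutative lin_plus.
Proof. by move=> f g; apply: linear_ext => x /=; rewrite addrC. Qed.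
Fact lin_plus0 : left_id lin_zero lin_plus.
Proof. by move=> f; apply: linear_ext => x /=; rewrite add0r. Qed.
Fact lin_plusN : left_inverse lin_zero lin_opp lin_plus.
Proof. by move=> f; apply: linear_ext => x /=; rewrite addNr. Qed.

HB.instance Definition _ := GRing.isZmodule.Build {linear U -> V}
  lin_plusA lin_plusC lin_plus0 lin_plusN.

End LinearGroup.

(* S = End_R(C) acting on the right of C, so that the product of S is
   [s * t = t \o s]. *)
Definition rend (R : pzRingType) (C : lmodType R) : Type := {linear C -> C}.

Section RightEnd.
Variables (R : pzRingType) (C : lmodType R).

HB.instance Definition _ := GRing.Zmodule.on (rend C).

Definition rend1 : rend C := idfun : {linear C -> C}.
Definition rendM (s t : rend C) : rend C :=
  ((t : {linear C -> C}) \o (s : {linear C -> C}) : {linear C -> C}).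

Fact rend_mulA : associative rendM.
Proof. by move=> s t u; apply: linear_ext. Qed.
Fact rend_mul1l : left_id rend1 rendM.
Proof. by move=> s; apply: linear_ext. Qed.
Fact rend_mul1r : right_id rend1 rendM.
Proof. by move=> s; apply: linear_ext. Qed.
Fact rend_mulDl : left_distributive rendM +%R.
Proof. by move=> s t u; apply: linear_ext => x /=; rewrite raddfD. Qed.
Fact rend_mulDr : right_distributive rendM +%R.
Proof. by move=> s t u; apply: linear_ext. Qed.

HB.instance Definition _ := GRing.Zmodule_isPzRing.Build (rend C)
  rend_mulA rend_mul1l rend_mul1r rend_mulDl rend_mulDr.

End RightEnd.

(* C as a right S-module: [c s = s(c)]. *)
Definition rmod (R : pzRingType) (C : lmodType R) : Type := C.

Section RightModule.
Variables (R : pzRingType) (C : lmodType R).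

HB.instance Definition _ := GRing.Zmodule.on (rmod C).

Definition rmod_act (s : (rend C)^c) (c : rmod C) : rmod C :=
  (s : {linear C -> C}) c.

Fact rmod_actA a b v : rmod_act a (rmod_act b v) = rmod_act (a * b) v.
Proof. by []. Qed.
Fact rmod_act1 : left_id 1 rmod_act.
Proof. by []. Qed.
Fact rmod_actDr : right_distributive rmod_act +%R.
Proof. by move=> s x y; apply: (raddfD (s : {linear C -> C})). Qed.
Fact rmod_actDl v : {morph rmod_act^~ v : a b / a + b}.
Proof. by []. Qed.

HB.instance Definition _ := GRing.Zmodule_isLmodule.Build (rend C)^c (rmod C)
  rmod_actA rmod_act1 rmod_actDr rmod_actDl.

End RightModule.

(* Hom_R(C, N) as a left S-module: [(s f)(c) = f(c s)]. *)
Section HomModule.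
Variables (R : pzRingType) (C N : lmodType R).

Definition hom_act (s : rend C) (f : {linear C -> N}) : {linear C -> N} :=
  f \o (s : {linear C -> C}).

Fact hom_actA a b v : hom_act a (hom_act b v) = hom_act (a * b) v.
Proof. by apply: linear_ext. Qed.
Fact hom_act1 : left_id 1 hom_act.
Proof. by move=> f; apply: linear_ext. Qed.
Fact hom_actDr : right_distributive hom_act +%R.
Proof. by move=> s f g; apply: linear_ext. Qed.
Fact hom_actDl v : {morph hom_act^~ v : a b / a + b}.
Proof. by move=> a b; apply: linear_ext => x /=; rewrite raddfD. Qed.

HB.instance Definition _ := GRing.Zmodule_isLmodule.Build (rend C)
  {linear C -> N} hom_actA hom_act1 hom_actDr hom_actDl.

End HomModule.

Definition int_rat : {pred rat} := fun x => x \is a Num.int.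
Fact int_rat_zmod : zmod_closed int_rat.
Proof. by split=> [|x y]; [apply: rpred0 | apply: rpredB]. Qed.
HB.instance Definition _ := GRing.isZmodClosed.Build rat int_rat int_rat_zmod.

(* Q/Z *)
Definition QmodZ : zmodType := Quotient.quot int_rat.

Definition charg (U : zmodType) : Type := {additive U -> QmodZ}.
HB.instance Definition _ (U : zmodType) := GRing.Zmodule.on (charg U).

(* [N^+] is a right R-module: [(phi r)(x) = phi (r x)]. *)
Section CharacterModule.
Variables (R : pzRingType) (N : lmodType R).

Definition charg_act (r : R^c) (phi : charg N) : charg N :=
  ((phi : {additive N -> QmodZ}) \o ( *:%R (r : R)) : {additive N -> QmodZ}).

Fact charg_actA a b v : charg_act a (charg_act b v) = charg_act (a * b) v.
Proof. by apply: additive_ext => x /=; rewrite scalerA. Qed.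
Fact charg_act1 : left_id 1 charg_act.
Proof. by move=> f; apply: additive_ext => x /=; rewrite scale1r. Qed.
Fact charg_actDr : right_distributive charg_act +%R.
Proof. by move=> s f g; apply: additive_ext. Qed.
Fact charg_actDl v : {morph charg_act^~ v : a b / a + b}.
Proof. by move=> a b; apply: additive_ext => x /=; rewrite scalerDl raddfD. Qed.

HB.instance Definition _ := GRing.Zmodule_isLmodule.Build R^c
  (charg N) charg_actA charg_act1 charg_actDr charg_actDl.

End CharacterModule.

(* The direct sum V^(I); the direct product V^I is the type [I -> V]. *)
Section DirectSum.
Variables I : Type.

Definition fin_support (V : zmodType) : {pred I -> V} :=
  fun f => `[< finite_set [set i | f i != 0] >].

Record dsum (V : zmodType) := DSum { dsum_val :> I -> V; _ : dsum_val \in @fin_support V }.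

HB.instance Definition _ (V : zmodType) := [isSub for @dsum_val V].
HB.instance Definition _ (V : zmodType) := [Choice of dsum V by <:].

Fact fin_support_zmod V : zmod_closed (@fin_support V).
Proof.
split=> [|f g /asboolP ff /asboolP fg]; apply/asboolP.
  by apply: (sub_finite_set _ (finite_set0 I)) => i /=; rewrite eqxx.
have /(sub_finite_set _) : finite_set ([set i | f i != 0] `|` [set i | g i != 0]).
  by rewrite finite_setU.
apply=> i /= fgi; case: (eqVneq (f i) 0) => [f0|]; last by left.
by right; apply: contraNneq fgi => g0; rewrite !fctE f0 g0 subr0.
Qed.

HB.instance Definition _ (V : zmodType) :=
  GRing.isZmodClosed.Build (I -> V) (@fin_support V) (@fin_support_zmod V).
HB.instance Definition _ (V : zmodType) := [SubChoice_isSubZmodule of dsum V by <:].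

Fact fin_support_submod (R : pzRingType) (V : lmodType R) : GRing.scaler_closed (@fin_support V).
Proof.
move=> r f /asboolP ff; apply/asboolP; apply: (sub_finite_set _ ff) => i /=.
by apply: contraNneq => f0; rewrite fctE f0 scaler0.
Qed.

HB.instance Definition _ (R : pzRingType) (V : lmodType R) :=
  GRing.isScaleClosed.Build R (I -> V) (@fin_support V) (@fin_support_submod R V).
HB.instance Definition _ (R : pzRingType) (V : lmodType R) :=
  [SubZmodule_isSubLmodule of dsum V by <:].

End DirectSum.

Section Tensor.
Variables (R : pzRingType) (M : lmodType R^c) (N : lmodType R).

Local Notation F := {freeg (M * N)%type / int}.
Let e (m : M) (n : N) : F := << (m, n) >>.

Inductive tens_gen : F -> Prop :=
| TensDl m m' n : tens_gen (e (m + m') n - e m n - e m' n)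
| TensDr m n n' : tens_gen (e m (n + n') - e m n - e m n')
| TensZ m (r : R) n : tens_gen (e ((r : R^c) *: m) n - e m (r *: n)).

Definition tens_ker : {pred F} := fun x =>
  `[< forall P : {pred F},
        zmod_closed P -> (forall y, tens_gen y -> y \in P) -> x \in P >].

Fact tens_ker_zmod : zmod_closed tens_ker.
Proof.
split=> [|x y /asboolP kx /asboolP ky]; apply/asboolP => P Pz gP.
  by case: Pz.
by case: (Pz) => _; apply; [apply: kx | apply: ky].
Qed.
HB.instance Definition _ := GRing.isZmodClosed.Build F tens_ker tens_ker_zmod.

Definition tens : Type := Quotient.quot tens_ker.
HB.instance Definition _ := GRing.Zmodule.on tens.

Definition tensor (m : M) (n : N) : tens := \pi_(Quotient.quot tens_ker) (e m n).

Definition balanced (A : zmodType) (b : M -> N -> A) : Prop :=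
  [/\ forall n, {morph b^~ n : m m' / m + m'},
      forall m, {morph b m : n n' / n + n'} &
      forall m (r : R) n, b ((r : R^c) *: m) n = b m (r *: n)].

(* The map [tens -> A] induced by a balanced map [b]. *)
Definition tens_lift (A : zmodType) (b : M -> N -> A) (x : tens) : A :=
  fglift (fun p => b p.1 p.2 : zmodule A) (repr x).

Section Lift.
Variables (A : zmodType) (b : M -> N -> A).
Hypothesis b_bal : balanced b.

Let L : F -> zmodule A := fglift (fun p => b p.1 p.2 : zmodule A).

Let L_B : {morph L : x y / x - y}.
Proof. exact: lift_is_additive. Qed.

Let L_e m n : L (e m n) = b m n.
Proof. by rewrite /L /e liftU scale1r. Qed.

Let L_ker x : x \in tens_ker -> L x = 0.
Proof.
move=> /asboolP /(_ (fun x => L x == 0)) kx; apply/eqP; apply: kx.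
  split=> [|u v]; first by rewrite unfold_in -(subrr (0 : F)) L_B subrr.
  by rewrite !unfold_in L_B => /eqP-> /eqP->; rewrite subrr.
case: b_bal => bDl bDr bZ _ [m m' n|m n n'|m r n]; rewrite unfold_in !L_B !L_e.
- by rewrite bDl [_ - b m n]addrAC subrr add0r subrr.
- by rewrite bDr [_ - b m n]addrAC subrr add0r subrr.
- by rewrite bZ subrr.
Qed.

Let lift_pi x : tens_lift b (\pi_(Quotient.quot tens_ker) x) = L x.
Proof.
apply/eqP; rewrite -subr_eq0 /tens_lift -/L -L_B; apply/eqP/L_ker.
by rewrite Quotient.idealrBE reprK.
Qed.

Lemma tens_lift_tensor m n : tens_lift b (tensor m n) = b m n.
Proof. by rewrite lift_pi L_e. Qed.

Lemma tens_lift_zmod : {morph tens_lift b : x y / x - y}.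
Proof.
move=> x y; rewrite -[x]reprK -[y]reprK -raddfB !lift_pi; exact: L_B.
Qed.

End Lift.

Let pi_eq (x y : F) :
  x - y \in tens_ker -> \pi_(Quotient.quot tens_ker) x = \pi y.
Proof. by rewrite Quotient.idealrBE => /eqP. Qed.

Lemma tensor_balanced : balanced tensor.
Proof.
have gen_ker x : tens_gen x -> x \in tens_ker.
  by move=> gx; apply/asboolP => P _; apply.
split=> [n m m'|m n n'|m r n].
- rewrite /tensor -[RHS]raddfD; apply/pi_eq; rewrite opprD addrA.
  exact/gen_ker/TensDl.
- rewrite /tensor -[RHS]raddfD; apply/pi_eq; rewrite opprD addrA.
  exact/gen_ker/TensDr.
- by apply/pi_eq/gen_ker/TensZ.
Qed.

Lemma tens_ind (P : tens -> Prop) :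
  P 0 -> (forall x y, P x -> P y -> P (x - y)) ->
  (forall m n, P (tensor m n)) -> forall x, P x.
Proof.
move=> P0 PB Pt x.
have PN y : P y -> P (- y) by move=> Py; rewrite -[- y]sub0r; apply: PB.
have PD y z : P y -> P z -> P (y + z).
  by move=> Py Pz; rewrite -[z]opprK; apply: PB => //; apply: PN.
rewrite -[x]reprK -(freeg_sumE (repr x)) raddf_sum; elim/big_ind: _ => //.
move=> [m n] _; rewrite -[coeff _ _]intz -freegU_mulz raddfMz.
have PM k : P (tensor m n *+ k) by elim: k => // k IHk; rewrite mulrS; apply: PD.
by case: (coeff _ _) => k; last rewrite NegzE mulrNz; [|apply: PN]; apply: PM.
Qed.

Lemma tens_ext (A : zmodType) (f g : tens -> A) :
  {morph f : x y / x - y} -> {morph g : x y / x - y} ->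
  (forall m n, f (tensor m n) = g (tensor m n)) -> f =1 g.
Proof.
move=> fB gB fg; apply: tens_ind => // [|x y fgx fgy].
  by rewrite -(subrr (0 : tens)) fB gB !subrr.
by rewrite fB gB fgx fgy.
Qed.

End Tensor.

(* The right End_R(N)-module structure: [(m (x) n) s = m (x) s(n)]. *)
Section TensorModule.
Variables (R : pzRingType) (M : lmodType R^c) (N : lmodType R).

Definition tens_act (s : (rend N)^c) : tens M N -> tens M N :=
  tens_lift (fun m n => tensor m ((s : {linear N -> N}) n)).

Let act_bal (s : (rend N)^c) :
  balanced (fun m n => tensor m ((s : {linear N -> N}) n) : tens M N).
Proof.
have [tDl tDr tZ] := tensor_balanced M N.
split=> [n m m'|m n n'|m r n]; rewrite ?linearD ?linearZ.
- exact: tDl.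
- exact: tDr.
- exact: tZ.
Qed.

Lemma tens_act_tensor s m n :
  tens_act s (tensor m n) = tensor m ((s : {linear N -> N}) n).
Proof. exact: tens_lift_tensor (act_bal s) m n. Qed.

Lemma tens_actB s : {morph tens_act s : x y / x - y}.
Proof. exact: tens_lift_zmod (act_bal s). Qed.

Fact tens_actA a b v : tens_act a (tens_act b v) = tens_act (a * b) v.
Proof.
move: v; apply: tens_ext => [x y|x y|m n]; rewrite ?tens_actB //.
by rewrite !tens_act_tensor.
Qed.
Fact tens_act1 : left_id 1 tens_act.
Proof. by apply: tens_ext => // [x y|m n]; rewrite ?tens_actB ?tens_act_tensor. Qed.
Fact tens_actDr : right_distributive tens_act +%R.
Proof.
have act0 s : tens_act s 0 = 0 by rewrite -{1}(subrr 0) tens_actB subrr.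
have actN s x : tens_act s (- x) = - tens_act s x.
  by rewrite -sub0r tens_actB act0 sub0r.
by move=> s x y; rewrite -{1}[y]opprK tens_actB actN opprK.
Qed.
Fact tens_actDl v : {morph tens_act^~ v : a b / a + b}.
Proof.
move=> a b; move: v; apply: tens_ext => [x y|x y|m n].
- exact: tens_actB.
- by rewrite !tens_actB addrACA opprD.
rewrite !tens_act_tensor; have [_ tDr _] := tensor_balanced M N; exact: tDr.
Qed.

HB.instance Definition _ := GRing.Zmodule_isLmodule.Build (rend N)^c
  (tens M N) tens_actA tens_act1 tens_actDr tens_actDl.

End TensorModule.

Definition exact_at (U V W : zmodType) (f : U -> V) (g : V -> W) : Prop :=
  forall y, g y = 0 <-> exists x, f x = y.

Definition surjective (U V : Type) (f : U -> V) : Prop := forall y, exists x, f x = y.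

Section HomologicalAlgebra.
Variable R : pzRingType.
Implicit Types M N P : lmodType R.

Definition short_exact (M' M M'' : lmodType R)
    (f : {linear M' -> M}) (g : {linear M -> M''}) : Prop :=
  [/\ injective f, exact_at f g & surjective g].

(* ... -> X_1 -> X_0 -> M -> 0, exact *)
Record resolution (M : lmodType R) := Resolution {
  res_obj :> nat -> lmodType R;
  res_d : forall n, {linear res_obj n.+1 -> res_obj n};
  res_aug : {linear res_obj 0 -> M};
  res_aug_surj : surjective res_aug;
  res_exact0 : exact_at (res_d 0) res_aug;
  res_exactS : forall n, exact_at (res_d n.+1) (res_d n)
}.

(* 0 -> M -> X^0 -> X^1 -> ..., exact *)
Record coresolution (M : lmodType R) := Coresolution {
  cores_obj :> nat -> lmodType R;
  cores_d : forall n, {linear cores_obj n -> cores_obj n.+1};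
  cores_aug : {linear M -> cores_obj 0};
  cores_aug_inj : injective cores_aug;
  cores_exact0 : exact_at cores_aug (cores_d 0);
  cores_exactS : forall n, exact_at (cores_d n) (cores_d n.+1)
}.

Definition projective (P : lmodType R) : Prop :=
  forall (M N : lmodType R) (p : {linear M -> N}) (f : {linear P -> N}),
    surjective p -> exists g : {linear P -> M}, forall x, p (g x) = f x.

Definition proj_resolution M (X : resolution M) : Prop :=
  forall n, projective (X n).

(* The cohomology of [Hom_R(X, N)] vanishes in degree [i]. *)
Definition hom_acyclic M (X : resolution M) N (i : nat) : Prop :=
  forall f : {linear X i -> N}, (forall x, f (res_d X i x) = 0) ->
  match i return {linear X i -> N} -> Prop with
  | 0 => fun f => f = 0
  | j.+1 => fun f => exists g : {linear X j -> N}, forall x, f x = g (res_d X j x)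
  end f.

(* Ext_R^i(M, N) = 0, computed on projective resolutions of M; these exist by
   [proj_resolution_exists] below. *)
Definition Ext_vanishes (i : nat) M N : Prop :=
  forall X : resolution M, proj_resolution X -> hom_acyclic X N i.

Definition modclass : Type := lmodType R -> Prop.

Definition subclass (X Y : modclass) : Prop := forall M, X M -> Y M.

(* M is isomorphic to a direct summand of N *)
Definition dsummand M N : Prop :=
  exists (K : lmodType R) (f : {linear (M * K)%type -> N}), bijective f.

(* res X: 0 -> X_n -> ... -> X_0 -> M -> 0 *)
Definition res (X : modclass) : modclass := fun M =>
  exists (Z : resolution M) (n : nat),
    (forall i, (i <= n)%N -> X (Z i)) /\
    (forall i, (n < i)%N -> forall x : Z i, x = 0).

(* cores X: 0 -> M -> X^0 -> ... -> X^n -> 0 *)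
Definition cores (X : modclass) : modclass := fun M =>
  exists (Z : coresolution M) (n : nat),
    (forall i, (i <= n)%N -> X (Z i)) /\
    (forall i, (n < i)%N -> forall x : Z i, x = 0).

Definition closed_extensions (X : modclass) : Prop :=
  forall M' M M'' (f : {linear M' -> M}) (g : {linear M -> M''}),
    short_exact f g -> X M' -> X M'' -> X M.

Definition closed_summands (X : modclass) : Prop :=
  forall M N, dsummand M N -> X N -> X M.

Definition closed_ker_epi (X : modclass) : Prop :=
  forall M' M M'' (f : {linear M' -> M}) (g : {linear M -> M''}),
    short_exact f g -> X M -> X M'' -> X M'.

Definition closed_coker_mono (X : modclass) : Prop :=
  forall M' M M'' (f : {linear M' -> M}) (g : {linear M -> M''}),
    short_exact f g -> X M' -> X M -> X M''.

Definition left_thick (X : modclass) : Prop :=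
  [/\ closed_extensions X, closed_summands X & closed_ker_epi X].

Definition right_thick (X : modclass) : Prop :=
  [/\ closed_extensions X, closed_summands X & closed_coker_mono X].

Definition left_weak_AB_context (X Y W : modclass) : Prop :=
  [/\ left_thick X,
      right_thick Y /\ subclass Y (res X),
      forall M, W M <-> X M /\ Y M,
      forall i M N, (1 <= i)%N -> X M -> W N -> Ext_vanishes i M N &
      forall M, X M ->
        exists (N M' : lmodType R) (f : {linear M -> N}) (g : {linear N -> M'}),
          [/\ short_exact f g, W N & X M']].

Definition right_weak_AB_context (W X Y : modclass) : Prop :=
  [/\ right_thick Y,
      left_thick X /\ subclass X (cores Y),
      forall M, W M <-> X M /\ Y M,
      forall i M N, (1 <= i)%N -> W M -> Y N -> Ext_vanishes i M N &
      forall M, Y M ->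
        exists (M' N : lmodType R) (f : {linear M' -> N}) (g : {linear N -> M}),
          [/\ short_exact f g, W N & Y M']].

End HomologicalAlgebra.

Section FreeModule.
Variables (R : pzRingType) (T : choiceType).
Local Notation F := (dsum T R^o).
Implicit Type x : F.

Let supp x : set T := [set i | x i != 0].

Let supp_fin x : finite_set (supp x).
Proof. by have /asboolP := valP x. Qed.

Fact delta_subproof t : (fun i => ((i == t)%:R : R^o)) \in @fin_support T R^o.
Proof.
apply/asboolP; apply: (sub_finite_set _ (finite_set1 t)) => i /=.
by apply: contra_neqP => /eqP; rewrite -[_ == _]/(i == t) => /negPf->.
Qed.

Definition delta t : F := DSum (delta_subproof t).

Section Combination.
Variables (N : lmodType R) (u : T -> N).

Definition lincomb x : N := \sum_(i <- fset_set (supp x)) (x i : R) *: u i.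

Lemma lincombE (A : {fset T}) x :
  supp x `<=` [set` A] -> lincomb x = \sum_(i <- A) (x i : R) *: u i.
Proof.
move=> sA; rewrite /lincomb; apply: big_fset_incl => [|i _].
  by apply/fsubsetP => i; rewrite in_fset_set // inE => /sA.
rewrite in_fset_set // notin_setE /= => /negP; rewrite negbK => /eqP ->.
by rewrite scale0r.
Qed.

Lemma lincomb_linear : linear lincomb.
Proof.
move=> a x y; pose A := (fset_set (supp x) `|` fset_set (supp y))%fset.
have sx : supp x `<=` [set` A].
  by move=> i xi; rewrite /= in_fsetU in_fset_set ?mem_set.
have sy : supp y `<=` [set` A].
  by move=> i yi; rewrite /= in_fsetU orbC in_fset_set ?mem_set.
have sz : supp (a *: x + y) `<=` [set` A].
  move=> i; have [xi _|] := boolP (x i != 0); first exact: (sx i xi).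
  rewrite negbK => /eqP xi; have [yi _|] := boolP (y i != 0); first exact: (sy i yi).
  by rewrite negbK => /eqP yi; rewrite /supp /= [X in X != 0](_ : _ = a * x i + y i) //
    xi yi mulr0 addr0 eqxx.
rewrite !(@lincombE A) // scaler_sumr -big_split /=; apply: eq_bigr => i _.
by rewrite scalerA -scalerDl.
Qed.

HB.instance Definition _ :=
  GRing.isLinear.Build R F N *:%R lincomb lincomb_linear.

Lemma lincomb_delta t : lincomb (delta t) = u t.
Proof.
rewrite (@lincombE [fset t]%fset) ?big_seq_fset1 /= ?eqxx ?scale1r //.
move=> i; rewrite /supp /= inE; apply: contra_neqT => /negPf it.
by rewrite it.
Qed.

End Combination.

Lemma delta_sum x : x = lincomb delta x.
Proof.
apply/val_inj/funext => j; rewrite [RHS](_ : _ =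
  \sum_(i <- fset_set (supp x)) (x i : R) * (j == i)%:R); last first.
  by rewrite /lincomb; elim/big_ind2: _ => // _ a _ b <- <-.
have [xj|] := boolP (x j != 0); last first.
  rewrite negbK => /eqP xj; rewrite [LHS]xj big1_seq // => i /andP[_].
  rewrite in_fset_set // inE /= => xi.
  by case: eqVneq xi => [<-|]; rewrite ?mulr0 // => /eqP; rewrite xj.
rewrite (bigD1_seq j) ?fset_uniq //= ?in_fset_set ?mem_set //.
rewrite eqxx mulr1 big1 ?addr0 // => i /negPf ij.
by rewrite eq_sym ij mulr0.
Qed.

Lemma free_projective : projective F.
Proof.
move=> M N p f /= p_surj.
have [a pa] := choice (fun t => p_surj (f (delta t))).
exists (lincomb a) => x; rewrite [in RHS](delta_sum x) /lincomb !raddf_sum.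
by apply: eq_bigr => i _; rewrite /= !linearZZ pa.
Qed.

End FreeModule.

Section ProjectiveResolution.
Variable R : pzRingType.

Section Kernel.
Variables (U V : lmodType R) (f : {linear U -> V}).

Definition in_ker : {pred U} := fun x => f x == 0.
Fact ker_zmod : zmod_closed in_ker.
Proof.
split=> [|x y]; rewrite !unfold_in ?linear0 // linearB => /eqP-> /eqP->.
by rewrite subrr.
Qed.
HB.instance Definition _ := GRing.isZmodClosed.Build U in_ker ker_zmod.
Fact ker_scale : GRing.scaler_closed in_ker.
Proof. by move=> a x; rewrite !unfold_in linearZZ => /eqP->; rewrite scaler0. Qed.
HB.instance Definition _ := GRing.isScaleClosed.Build R U in_ker ker_scale.

Record kernel := Kernel { ker_val : U; _ : ker_val \in in_ker }.
HB.instance Definition _ := [isSub for ker_val].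
HB.instance Definition _ := [Choice of kernel by <:].
HB.instance Definition _ := [SubChoice_isSubZmodule of kernel by <:].
HB.instance Definition _ := [SubZmodule_isSubLmodule of kernel by <:].

End Kernel.

Let cover (M : lmodType R) : {linear dsum M R^o -> M} := lincomb id.

Let cover_surj M : surjective (cover M).
Proof. by move=> x; exists (delta R x); apply: lincomb_delta. Qed.

Let syz (M : lmodType R) : lmodType R := kernel (cover M).

Let syzd (M : lmodType R) : {linear dsum (syz M) R^o -> dsum M R^o} :=
  (val : {linear syz M -> dsum M R^o}) \o cover (syz M).

Let syzd_ker M x : syzd M x = 0 <-> cover (syz M) x = 0.
Proof.
split=> e; first exact: val_inj.
by rewrite -[RHS]/(val (0 : syz M)) -e.
Qed.

Let kernelP (U V : lmodType R) (f : {linear U -> V}) (x : kernel f) :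
  f (val x) = 0.
Proof. exact: (eqP (valP x)). Qed.

Let kernel_lift (U V : lmodType R) (f : {linear U -> V}) (y : U) :
  f y = 0 -> exists x : kernel f, val x = y.
Proof.
move=> fy; have ky : y \in in_ker f by rewrite unfold_in fy.
by exists (Kernel ky).
Qed.

Let syzd_exact M : exact_at (syzd M) (cover M).
Proof.
move=> y; split=> [/kernel_lift [k <-] | [x <-]]; last exact: kernelP.
by have [x <-] := cover_surj k; exists x.
Qed.

Lemma proj_resolution_exists (M : lmodType R) :
  exists X : resolution M, proj_resolution X.
Proof.
pose K := fix K n := if n is k.+1 then syz (K k) else M.
have exS n : exact_at (syzd (K n.+1)) (syzd (K n)).
  by move=> y; split=> [/syzd_ker/syzd_exact//|/syzd_exact/syzd_ker].
exists (@Resolution R M (fun n => dsum (K n) R^o) (fun n => syzd (K n))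
  (cover M) (@cover_surj M) (@syzd_exact M) exS) => n.
exact: free_projective.
Qed.

End ProjectiveResolution.

Section Tor.
Variable R : pzRingType.

Definition tens_mapl (M M' : lmodType R^c) (f : {linear M -> M'})
    (N : lmodType R) : tens M N -> tens M' N :=
  tens_lift (fun m n => tensor (f m) n).

Lemma tens_mapl_tensor (M M' : lmodType R^c) (f : {linear M -> M'})
    (N : lmodType R) m n :
  @tens_mapl M M' f N (tensor m n) = tensor (f m) n.
Proof.
have [tDl tDr tZ] := tensor_balanced M' N.
apply: tens_lift_tensor; split=> [y x x'|x|x r y].
- by rewrite linearD tDl.
- exact: tDr.
- by rewrite linearZZ tZ.
Qed.

(* The homology of [X (x)_R N] vanishes in degree [i]. *)
Definition tens_acyclic (M : lmodType R^c) (X : resolution M)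
    (N : lmodType R) (i : nat) : Prop :=
  match i with
  | 0 => surjective (@tens_mapl _ _ (res_d X 0) N)
  | j.+1 => exact_at (@tens_mapl _ _ (res_d X j.+1) N)
                     (@tens_mapl _ _ (res_d X j) N)
  end.

(* Tor^R_i(M, N) = 0, as the derived functor of [- (x)_R N] *)
Definition Tor_vanishes (i : nat) (M : lmodType R^c) (N : lmodType R) : Prop :=
  forall X : resolution M, proj_resolution X -> tens_acyclic X N i.

End Tor.

Section CanonicalMaps.
Variables (R : pzRingType) (C : lmodType R).

Section SelfSmall.
Variable I : Type.
Implicit Type f : dsum I {linear C -> C}.

Fact dsum_hom_subproof f (c : C) : (fun i => f i c) \in @fin_support I C.
Proof.
have /asboolP ff := valP f; apply/asboolP; apply: (sub_finite_set _ ff) => i /=.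
by apply: contraNneq => ->.
Qed.

Definition dsum_hom_fun f (c : C) : dsum I C := DSum (dsum_hom_subproof f c).

Fact dsum_hom_linear f : linear (dsum_hom_fun f).
Proof.
by move=> a x y; apply: val_inj; apply: funext => i; rewrite /= linearP.
Qed.

HB.instance Definition _ f :=
  GRing.isLinear.Build R C (dsum I C) *:%R (dsum_hom_fun f) (dsum_hom_linear f).

(* Hom_R(C, C)^(I) -> Hom_R(C, C^(I)) *)
Definition dsum_hom f : {linear C -> dsum I C} := dsum_hom_fun f.

End SelfSmall.

(* (C^+)^I (x)_R C -> (C^+ (x)_R C)^I *)
Definition tens_prod (I : Type) :
    tens ((I -> charg C) : lmodType R^c) C -> (I -> tens (charg C) C) :=
  tens_lift (fun (phi : I -> charg C) c i => tensor (phi i) c).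

Lemma tens_prod_tensor (I : Type) (phi : I -> charg C) c :
  tens_prod (tensor (phi : (I -> charg C) : lmodType R^c) c) =
  fun i => tensor (phi i) c.
Proof.
have [tDl tDr tZ] := tensor_balanced (charg C : lmodType R^c) C.
apply: tens_lift_tensor.
split=> [y x x'|x y y'|x r y]; apply: funext => i.
- exact: tDl.
- exact: tDr.
- exact: tZ.
Qed.

Definition eval_char_fun (phi : charg C) (c : C) (f : {linear C -> C}) : QmodZ :=
  (phi : {additive C -> QmodZ}) (f c).

Fact eval_char_zmod phi c : zmod_morphism (eval_char_fun phi c).
Proof. by move=> f g; rewrite /eval_char_fun /= raddfB. Qed.

HB.instance Definition _ phi c :=
  GRing.isZmodMorphism.Build {linear C -> C} QmodZ (eval_char_fun phi c)
    (eval_char_zmod phi c).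

Definition eval_char (phi : charg C) (c : C) : charg {linear C -> C} :=
  (eval_char_fun phi c : {additive {linear C -> C} -> QmodZ}).

(* C^+ (x)_R C -> Hom_R(C, C)^+ *)
Definition tens_char : tens (charg C) C -> charg {linear C -> C} :=
  tens_lift eval_char.

Lemma tens_char_tensor phi c : tens_char (tensor phi c) = eval_char phi c.
Proof.
apply: tens_lift_tensor; split=> [y x x'|x y y'|x r y].
- by apply: additive_ext.
- by apply: additive_ext => f; rewrite /= /eval_char_fun linearD raddfD.
- by apply: additive_ext => f; rewrite /= /eval_char_fun linearZZ.
Qed.

(* C (x)_S Hom_R(C, N) -> N *)
Definition tens_eval (N : lmodType R) : tens (rmod C) {linear C -> N} -> N :=
  tens_lift (fun (c : rmod C) (f : {linear C -> N}) => f c).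

Lemma tens_eval_tensor (N : lmodType R) (c : rmod C) (f : {linear C -> N}) :
  tens_eval (tensor c f) = f c.
Proof. by apply: tens_lift_tensor; split=> // g x y; apply: linearD. Qed.

Section Coevaluation.
Variable M : lmodType R^c.

Definition coeval_fun (m : M) (c : rmod C) : tens M C := tensor m (c : C).

Fact coeval_linear m : linear (coeval_fun m).
Proof.
move=> s x y; have [_ tDr _] := tensor_balanced M C.
by rewrite /coeval_fun [LHS]tDr -tens_act_tensor.
Qed.

HB.instance Definition _ m :=
  GRing.isLinear.Build (rend C)^c (rmod C) (tens M C) *:%R (coeval_fun m)
    (coeval_linear m).

(* M -> Hom_S(C, M (x)_R C) *)
Definition coeval (m : M) : {linear rmod C -> tens M C} := coeval_fun m.

End Coevaluation.

End CanonicalMaps.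

Section Classes.
Variables (R : pzRingType) (C : lmodType R).

Definition self_small : Prop :=
  forall I : Type, bijective (@dsum_hom R C I).

Definition self_co_small : Prop :=
  (forall I : Type, bijective (@tens_prod R C I)) /\ bijective (@tens_char R C).

Definition sigma_self_orthogonal : Prop :=
  forall (I : Type) i, (1 <= i)%N -> Ext_vanishes i C (dsum I C).

Definition prod_Tor_orthogonal : Prop :=
  forall (I : Type) i, (1 <= i)%N ->
    Tor_vanishes i ((I -> charg C) : lmodType R^c) C.

Definition Add_class : modclass R := fun M =>
  exists I : Type, dsummand M (dsum I C).

Definition Prod_char_class : modclass R^c := fun M =>
  exists I : Type, dsummand M ((I -> charg C) : lmodType R^c).

Definition Bass_class : modclass R := fun N =>
  [/\ forall i, (1 <= i)%N -> Ext_vanishes i C N,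
      forall i, (1 <= i)%N -> Tor_vanishes i (rmod C) {linear C -> N} &
      bijective (@tens_eval R C N)].

Definition Auslander_class : modclass R^c := fun M =>
  [/\ forall i, (1 <= i)%N -> Tor_vanishes i M C,
      forall i, (1 <= i)%N -> Ext_vanishes i (rmod C) (tens M C) &
      bijective (@coeval R C M)].

End Classes.

(* Main.v *)
(* Everything about Ext is reduced to Ext^1: for n >= 0, Ext^{n+1}(M, N) = 0 iff
   Ext^1(M, N') = 0 for the n-th cosyzygy N' of N, iff Ext^1(K, N) = 0 for an n-th
   syzygy K of M.  Tor is reduced to Ext by Tor_i(M, N)^+ = Ext^i(M, N^+), which is
   faithful because Q/Z is an injective cogenerator.  The classes B_C and A_C are
   then thick by the five lemma; they contain C^(I) and (C^+)^I because
   C (x)_S S^(I) = C^(I) and (C^+)^I (x)_R C = (S^+)^I; and the evaluation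
   C^(Hom(C, N)) -> N, respectively M -> (C^+)^(Hom(M, C^+)), supplies the
   covers required in the definition of a weak AB-context.

   The rest is Auslander-Buchweitz theory.  The least obvious step is that
   cores(Add C) is closed under summands: if 0 -> M (+) M' -> W -> L -> 0 is the
   beginning of a coresolution, the Mayer-Vietoris sequence
   0 -> W -> W/M (+) W/M' -> L -> 0 shows that W/M (+) W/M' has a coresolution
   shorter than that of M (+) M', and one concludes by induction. *)

From HB Require Import structures.
Require Import Defs.
From mathcomp Require Import all_boot all_algebra finmap.
From mathcomp Require Import boolp classical_sets functions cardinality.

Set Implicit Arguments.
Unset Strict Implicit.
Unset Printing Implicit Defensive.

Import GRing.Theory Num.Theory.
Local Open Scope ring_scope.

(** No Ext or Tor group is formed. The definitions quantify over all projective resolutions;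
    bringing vanishing to a form that mentions none settles independence of the resolution. Each
    fragment of a long exact sequence becomes an implication between vanishing statements, and where
    a connecting map would occur there is instead a hypothesis that certain maps extend or lift. The
    kernel of C^(Hom(C, N)) -> N lies in B_C because Hom(C, -) keeps this particular sequence exact,
    and dually for A_C; hence the corresponding closure lemmas carry a lifting or extension
    hypothesis. Self-smallness enters through Hom(C, C^(I)) = S^(I) and self-co-smallness through
    (C^+)^I (x)_R C = (S^+)^I. As S^+ is coinduced, the character module of the former and the
    latter itself are injective right S-modules, which disposes of the higher Tor and Ext over S. *)

Definition mk_additive (U V : zmodType) (f : U -> V) (fB : zmod_morphism f) :
  {additive U -> V} := HB.pack f (GRing.isZmodMorphism.Build U V f fB).

Definition mk_linear (R : pzRingType) (U V : lmodType R) (f : U -> V)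
    (f_lin : linear f) : {linear U -> V} :=
  HB.pack f (GRing.isLinear.Build R U V *:%R f f_lin).

Lemma subrACA (V : zmodType) (a b c d : V) : a - b - (c - d) = a - c - (b - d).
Proof. by rewrite !opprD !opprK addrACA. Qed.

(** * Characters *)

Local Notation piQZ := (\pi_QmodZ%qT : {additive rat -> QmodZ}).

Lemma QmodZ_pi_eq0 (x : rat) : (piQZ x == 0) = (x \is a Num.int).
Proof. by rewrite -(raddf0 piQZ) -Quotient.idealrBE subr0. Qed.

Lemma QmodZ_divisible (d : nat) (q : QmodZ) : (0 < d)%N ->
  exists q', q' *+ d = q.
Proof.
move=> d_gt0; exists (piQZ (repr q / d%:R)).
rewrite -raddfMn -[_ *+ d]mulr_natr divfK; last by rewrite pnatr_eq0 -lt0n.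
exact: reprK.
Qed.

Lemma QmodZ_torsion (d : nat) : (1 < d)%N ->
  exists2 q : QmodZ, q != 0 & q *+ d = 0.
Proof.
move=> d_gt1; have d_neq0 : d%:R != 0 :> rat by rewrite pnatr_eq0 -lt0n ltnW.
exists (piQZ d%:R^-1).
  rewrite QmodZ_pi_eq0; apply/negP => /intrP [m dm].
  have : (m * d%:Z)%:~R = 1%:~R :> rat by rewrite intrM -dm mulVf.
  move=> /eqP; rewrite eqr_int => /eqP md.
  have := congr1 absz md; rewrite abszM /= => /eqP.
  by rewrite muln_eq1 => /andP[_ /eqP d1]; rewrite d1 in d_gt1.
by apply/eqP; rewrite -raddfMn -[_ *+ d]mulr_natr mulVf // QmodZ_pi_eq0 rpred1.
Qed.

(** * Extension of characters by Zorn's lemma *)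

Section CharacterExtension.
Local Open Scope classical_set_scope.
Variable B : zmodType.
Implicit Types G : set (B * QmodZ).

(** Graph of a homomorphism to Q/Z defined on a subgroup of [B]; with graphs, the union of a chain
    is a plain union of sets. The empty set also qualifies, so [0] in [G] is a separate hypothesis
    below. *)
Definition partial_char G :=
  (forall p q, G p -> G q -> G (p - q)) /\ (forall y, G (0, y) -> y = 0).

Section Theory.
Variable G : set (B * QmodZ).
Hypotheses (pG : partial_char G) (G0 : G 0).

Lemma partial_charN p : G p -> G (- p).
Proof. by rewrite -sub0r; apply: pG.1. Qed.

Lemma partial_charD p q : G p -> G q -> G (p + q).
Proof. by rewrite -[q in G (_ + q)]opprK => Gp /partial_charN; apply: pG.1. Qed.

Lemma partial_charMn x y n : G (x, y) -> G (x *+ n, y *+ n).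
Proof.
move=> Gxy; elim: n => [|n IHn]; first by rewrite !mulr0n.
by rewrite !mulrS; apply: (partial_charD Gxy IHn).
Qed.

Lemma partial_char_fun x y y' : G (x, y) -> G (x, y') -> y = y'.
Proof.
move=> Gy Gy'; apply/eqP; rewrite -subr_eq0; apply/eqP/pG.2.
by rewrite -[X in (X, _)](subrr x); apply: (pG.1 (x, y) (x, y')).
Qed.

(* The nonzero value [q] makes the extended characters separate points. *)
Lemma partial_char_value b : (forall y, ~ G (b, y)) ->
  exists2 q, q != 0 & forall n y, G (b *+ n, y) -> y = q *+ n.
Proof.
move=> Gb; case: (pselect (exists n, (0 < n)%N && `[< exists y, G (b *+ n, y) >])).
  move=> /ex_minnP [d /andP[d_gt0 /asboolP[z Gz]] d_min].
  have d_gt1 : (1 < d)%N.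
    by rewrite ltn_neqAle d_gt0 andbT; apply/eqP => d1; apply: (Gb z); rewrite -d1 in Gz.
  have [q [q0 qz]] : exists q, q != 0 /\ q *+ d = z.
    have [q qz] := QmodZ_divisible z d_gt0.
    (* Here [d] is the least positive integer with [b *+ d] in the domain. If [q = 0] then [z = 0],
       and any nonzero [d]-torsion element serves as well; one exists because [d = 1] would put [b]
       itself in the domain. *)
    have [q0|] := eqVneq q 0; last by exists q.
    have [t t0 td] := QmodZ_torsion d_gt1.
    by exists t; split=> //; rewrite td -qz q0 mul0rn.
  exists q => // n y Gy.
  have Gr : G (b *+ (n %% d)%N, y - q *+ (n %/ d * d)).
    have -> : b *+ (n %% d) = b *+ n - b *+ d *+ (n %/ d).
      by rewrite {2}(divn_eq n d) mulrnDr mulnC mulrnA addrC addKr.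
    rewrite mulnC mulrnA qz.
    by apply: (pG.1 (_, _) (_, _) Gy); apply: partial_charMn.
  have [r0|r_gt0] := posnP (n %% d)%N.
    move: Gr; rewrite r0 mulr0n => /pG.2/eqP; rewrite subr_eq0 => /eqP ->.
    by rewrite {2}(divn_eq n d) r0 addn0.
  have /d_min : (0 < n %% d)%N && `[< exists y, G (b *+ (n %% d)%N, y) >].
    by rewrite r_gt0; apply/asboolP; eexists; exact: Gr.
  by rewrite leqNgt ltn_mod d_gt0.
move=> nG; have [q q0 _] := QmodZ_torsion (ltnSn 1).
exists q => // -[|n] y Gy; first by rewrite mulr0n; apply: pG.2.
by case: nG; exists n.+1; apply/asboolP; exists y.
Qed.

Lemma partial_char_adjoin b : (forall y, ~ G (b, y)) ->
  exists2 q, q != 0 & exists2 G', partial_char G' & G `<=` G' /\ G' (b, q).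
Proof.
move=> /partial_char_value [q q0 qP]; exists q => //.
have qPz (n : int) y : G (b *~ n, y) -> y = q *~ n.
  case: n => n; first exact: qP.
  rewrite NegzE !mulrNz => /partial_charN; rewrite -[- (_, _)]/(- - _, - _) opprK.
  by move=> /qP yE; rewrite -[y]opprK yE.
(* The extension is [G + Z (b, q)]; [qPz] is exactly its single-valuedness. *)
exists [set p | exists n : int, G (p.1 - b *~ n, p.2 - q *~ n)]; first split.
- move=> [x y] [x' y'] [n /= Gp] [n' /= Gp']; exists (n - n') => /=.
  rewrite !mulrzBr [x - x' - _]subrACA [y - y' - _]subrACA.
  exact: (pG.1 (_, _) (_, _) Gp Gp').
- move=> y [n] /=; rewrite sub0r -mulrNz => /qPz /eqP.
  by rewrite mulrNz subr_eq addNr => /eqP.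
split; first by move=> [x y] Gp; exists 0; rewrite /= !mulr0z !subr0.
by exists 1; rewrite /= !mulr1z !subrr.
Qed.

End Theory.

Lemma partial_char_extend G : partial_char G -> G 0 ->
  exists chi : {additive B -> QmodZ}, forall x y, G (x, y) -> chi x = y.
Proof.
(* Zorn's lemma also asks for the union of the empty chain, so [P] must hold of the empty set.
   Containing [G] is therefore expressed by stability under adding elements of [G], which amounts to
   inclusion as soon as [0] is in [G']. *)
move=> pG G0; pose P G' := partial_char G' /\ forall p q, G p -> G' q -> G' (p + q).
have [F FP Ftot|A [[pA GA] Amax]] := @Zorn_bigcup _ P.
  have Fchain p q : (\bigcup_(X in F) X) p -> (\bigcup_(X in F) X) q ->
      exists2 X, F X & X p /\ X q.
    move=> [X FX Xp] [Y FY Yq].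
    by have [XY|YX] := Ftot X Y FX FY; [exists Y|exists X] => //; split; auto.
  split; first split.
  - move=> p q /Fchain /[apply] -[X FX [Xp Xq]]; exists X => //.
    by have [[XB _] _] := FP X FX; apply: XB.
  - by move=> y [X FX]; have [[_ X0] _] := FP X FX; apply: X0.
  - by move=> p q Gp [X FX Xq]; exists X => //; have [_] := FP X FX; apply.
have A0 : A 0.
  have [A0|/eqP/set0P[p Ap]] := pselect (A = set0).
    have PG : P G by split=> //; apply: partial_charD.
    case: (Amax G) => //; rewrite A0; split=> //.
    by move=> /(_ 0 G0).
  by rewrite -(subrr p); apply: pA.1.
have subGA : G `<=` A by move=> p Gp; rewrite -[p]addr0; apply: GA.
have Atot b : exists y, A (b, y).
  apply: contrapT => nA.
  have [|q _ [A' pA' [AA' A'b]]] := @partial_char_adjoin A pA A0 b.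
    by move=> y Ay; apply: nA; exists y.
  apply: (Amax A').
    by split=> // /(_ _ A'b) Ab; apply: nA; exists q.
  split=> // p q' Gp; apply: partial_charD => //; [exact: AA'|exact/AA'/subGA].
have [chi chiP] := choice Atot.
have chiB : zmod_morphism chi.
  move=> x y; apply: (partial_char_fun pA (chiP _)).
  exact: (pA.1 (_, _) (_, _)).
exists (mk_additive chiB) => x y /subGA; exact: (partial_char_fun pA).
Qed.

End CharacterExtension.

(** Injectivity of Q/Z, for a map [g] that need not be injective, so that quotients and images need
    not be formed: [G] is the graph of the character that [chi] induces on the image of [g]. *)
Lemma char_extend (B D : zmodType) (g : {additive B -> D})
    (chi : {additive B -> QmodZ}) : (forall x, g x = 0 -> chi x = 0) ->
  exists psi : {additive D -> QmodZ}, forall x, psi (g x) = chi x.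
Proof.
move=> gchi; pose G := [set p : D * QmodZ | exists x, p = (g x, chi x)]%classic.
have [||psi psiP] := @partial_char_extend D G.
- split=> [_ _ [x ->] [x' ->]|y [x [/esym/gchi <-]] //].
  by exists (x - x'); rewrite !raddfB.
- by exists 0; rewrite !raddf0.
by exists psi => x; apply: psiP; exists x.
Qed.

(** Q/Z is a cogenerator: the zero character on the image of [g] is extended to [d] with a nonzero
    value, then to all of [D]. *)
Lemma char_separate (B D : zmodType) (g : {additive B -> D}) (d : D) :
  ~ (exists x, g x = d) ->
  exists2 psi : {additive D -> QmodZ}, forall x, psi (g x) = 0 & psi d != 0.
Proof.
move=> gd; pose G := [set p : D * QmodZ | p.2 = 0 /\ exists x, g x = p.1]%classic.
have pG : partial_char G.
  split=> [[_ _] [_ _] [/= -> [x <-]] [/= -> [x' <-]]|y []//].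
  by split=> /=; [rewrite subrr|exists (x - x'); rewrite raddfB].
have G0 : G 0 by split=> //; exists 0; rewrite raddf0.
have [y [_ /gd]//|q q0 [G' pG' [GG' G'd]]] := @partial_char_adjoin D G pG G0 d.
have [|psi psiP] := partial_char_extend pG'; first exact: GG'.
exists psi => [x|]; last by rewrite (psiP _ _ G'd).
by apply/psiP/GG'; split=> //; exists x.
Qed.

Lemma char_neq0 (D : zmodType) (d : D) : d != 0 ->
  exists psi : {additive D -> QmodZ}, psi d != 0.
Proof.
move=> d0; have [|psi _ psid] := @char_separate D D \0 d; last by exists psi.
by case=> _ /= /esym/eqP; apply/negP.
Qed.

(** * Short exact sequences *)

Section Modules.
Variable R : pzRingType.
Implicit Types A B D K M N P : lmodType R.

Lemma linear_desc A B N (g : {linear A -> B}) (h : {linear A -> N}) :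
  surjective g -> (forall x, g x = 0 -> h x = 0) ->
  exists k : {linear B -> N}, forall x, k (g x) = h x.
Proof.
move=> /choice [s gs] gh.
have hs x y : g x = g y -> h x = h y.
  by move=> /eqP; rewrite -subr_eq0 -raddfB => /eqP/gh/eqP; rewrite raddfB subr_eq0 => /eqP.
have k_lin : linear (fun y => h (s y)).
  by move=> a x y; rewrite -linearP; apply: hs; rewrite linearP !gs.
by exists (mk_linear k_lin) => x; apply: hs; rewrite gs.
Qed.

Lemma linear_lift A B N (f : {linear A -> B}) (h : {linear N -> B}) :
  injective f -> (forall x, exists y, f y = h x) ->
  exists k : {linear N -> A}, forall x, f (k x) = h x.
Proof.
move=> f_inj /choice [s fs].
have s_lin : linear s by move=> a x y; apply: f_inj; rewrite linearP !fs linearP.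
by exists (mk_linear s_lin).
Qed.

Lemma linear_inj A B (f : {linear A -> B}) :
  (forall x, f x = 0 -> x = 0) -> injective f.
Proof.
move=> f0 x y /eqP; rewrite -subr_eq0 -raddfB => /eqP/f0/eqP.
by rewrite subr_eq0 => /eqP.
Qed.

Section Cokernel.
Variables (U V : lmodType R) (f : {linear U -> V}).

Definition in_im : {pred V} := fun y => `[< exists x, f x = y >].
Fact im_zmod : zmod_closed in_im.
Proof.
split=> [|x y /asboolP[u <-] /asboolP[v <-]]; apply/asboolP.
  by exists 0; rewrite raddf0.
by exists (u - v); rewrite raddfB.
Qed.
HB.instance Definition _ := GRing.isZmodClosed.Build V in_im im_zmod.

Definition coker : Type := Quotient.quot in_im.
HB.instance Definition _ := GRing.Zmodule.on coker.

Let pi : {additive V -> Quotient.quot in_im} := \pi_(Quotient.quot in_im)%qT.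

Let pi_eq x y : (pi x = pi y) <-> exists u, f u = x - y.
Proof.
split=> [/eqP|[u uE]]; first by rewrite -Quotient.idealrBE => /asboolP.
by apply/eqP; rewrite -Quotient.idealrBE; apply/asboolP; exists u.
Qed.

Definition coker_scale (a : R) (x : coker) : coker := pi (a *: repr x).

Let coker_scale_pi a x : coker_scale a (pi x) = pi (a *: x).
Proof.
have /pi_eq[u uE] : pi (repr (pi x)) = pi x := reprK _.
by apply/pi_eq; exists (a *: u); rewrite linearZZ uE scalerBr.
Qed.

Fact coker_scaleA a b v : coker_scale a (coker_scale b v) = coker_scale (a * b) v.
Proof. by rewrite [LHS]coker_scale_pi scalerA. Qed.
Fact coker_scale1 : left_id 1 coker_scale.
Proof. by move=> v; rewrite /coker_scale scale1r; apply: reprK. Qed.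
Fact coker_scaleDr : right_distributive coker_scale +%R.
Proof.
have pi_repr u : u = pi (repr u) by symmetry; apply: reprK.
move=> a x y; rewrite (pi_repr x) (pi_repr y) -[X in coker_scale a X]raddfD.
by rewrite !coker_scale_pi scalerDr raddfD.
Qed.
Fact coker_scaleDl v : {morph coker_scale^~ v : a b / a + b}.
Proof. by move=> a b; rewrite /coker_scale scalerDl -[RHS]raddfD. Qed.

HB.instance Definition _ := GRing.Zmodule_isLmodule.Build R coker
  coker_scaleA coker_scale1 coker_scaleDr coker_scaleDl.

Fact coker_proj_linear : linear (pi : V -> coker).
Proof. by move=> a x y; rewrite raddfD -coker_scale_pi. Qed.
Definition coker_proj : {linear V -> coker} := mk_linear coker_proj_linear.

Lemma coker_proj_surj : surjective coker_proj.
Proof. by move=> x; exists (repr x); apply: reprK. Qed.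

Lemma coker_proj_exact : exact_at f coker_proj.
Proof.
move=> y; rewrite -(raddf0 coker_proj); split=> [/pi_eq[u]|[x fx]].
  by rewrite subr0; exists u.
by apply/pi_eq; exists x; rewrite subr0.
Qed.

Lemma short_exact_coker : injective f -> short_exact f coker_proj.
Proof. by split=> //; [exact: coker_proj_exact|exact: coker_proj_surj]. Qed.

End Cokernel.

Definition ker_incl A B (f : {linear A -> B}) : {linear kernel f -> A} := val.

Arguments ker_incl : simpl never.

Lemma ker_incl_exact A B (f : {linear A -> B}) : exact_at (ker_incl f) f.
Proof.
move=> y; split=> [fy|[x <-]]; last exact: (eqP (valP x)).
have ky : y \in in_ker f by rewrite unfold_in fy.
by exists (Kernel ky).
Qed.

Lemma short_exact_ker A B (f : {linear A -> B}) :
  surjective f -> short_exact (ker_incl f) f.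
Proof. by move=> f_surj; split=> //; exact: ker_incl_exact. Qed.

Section ShortExact.
Variables (A B D : lmodType R) (f : {linear A -> B}) (g : {linear B -> D}).
Hypothesis fg : short_exact f g.

Lemma short_exact_inj : injective f. Proof. by case: fg. Qed.
Lemma short_exact_surj : surjective g. Proof. by case: fg. Qed.
Lemma short_exact_im y : g y = 0 -> exists x, f x = y.
Proof. by case: fg => _ /(_ y) [] . Qed.
Lemma short_exact_comp x : g (f x) = 0.
Proof. by case: fg => _ fg0 _; apply/fg0; exists x. Qed.

Lemma short_exact_desc N (h : {linear B -> N}) : (forall x, h (f x) = 0) ->
  exists k : {linear D -> N}, forall x, k (g x) = h x.
Proof.
move=> hf; apply: linear_desc => [|x /short_exact_im[y <-]//].
exact: short_exact_surj.
Qed.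

Lemma short_exact_lift N (h : {linear N -> B}) : (forall x, g (h x) = 0) ->
  exists k : {linear N -> A}, forall x, f (k x) = h x.
Proof.
move=> gh; apply: linear_lift => [|x]; first exact: short_exact_inj.
exact: short_exact_im.
Qed.

End ShortExact.

(** * Injective modules *)

Definition injective_module N := forall A B (f : {linear A -> B}) (h : {linear A -> N}),
  injective f -> exists k : {linear B -> N}, forall x, k (f x) = h x.

Lemma prod_injective (I : Type) N : injective_module N ->
  injective_module ((I -> N) : lmodType R).
Proof.
move=> N_inj A B f h f_inj.
have h_lin i : linear (fun x => h x i) by move=> a x y; rewrite linearP.
have /choice [k kf] i := N_inj A B f (mk_linear (h_lin i)) f_inj.
have k_lin : linear (fun x i => k i x).
  by move=> a x y; apply: funext => i; rewrite linearP.
by exists (mk_linear k_lin) => x; apply: funext => i; apply: kf.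
Qed.

(** A direct summand described without its complement (see [dsummandE]). In this form additive
    functors visibly preserve it: they are applied to [i] and [r]. *)
Definition retract M N :=
  exists (i : {linear M -> N}) (r : {linear N -> M}), cancel i r.

Lemma retract_injective M N : retract M N -> injective_module N -> injective_module M.
Proof.
move=> [i [r ir]] N_inj A B f h f_inj.
have [k kf] := N_inj A B f (i \o h) f_inj.
by exists (r \o k) => x /=; rewrite kf /= ir.
Qed.

End Modules.

(* Hom_Z(R, Q/Z) as a left R-module: [(a phi)(r) = phi(r a)]. *)
Definition coind (R : pzRingType) : Type := {additive R -> QmodZ}.
HB.instance Definition _ (R : pzRingType) := GRing.Zmodule.on (coind R).

Section Coinduced.
Variable R : pzRingType.
Implicit Types I M N : lmodType R.

Definition coind_scale (a : R) (phi : coind R) : coind R :=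
  (phi : {additive R -> QmodZ}) \o mk_additive (mulrBl a).

Fact coind_scaleA a b v : coind_scale a (coind_scale b v) = coind_scale (a * b) v.
Proof. by apply: additive_ext => x /=; rewrite mulrA. Qed.
Fact coind_scale1 : left_id 1 coind_scale.
Proof. by move=> f; apply: additive_ext => x /=; rewrite mulr1. Qed.
Fact coind_scaleDr : right_distributive coind_scale +%R.
Proof. by move=> s f g; apply: additive_ext. Qed.
Fact coind_scaleDl v : {morph coind_scale^~ v : a b / a + b}.
Proof. by move=> a b; apply: additive_ext => x /=; rewrite mulrDr raddfD. Qed.

HB.instance Definition _ := GRing.Zmodule_isLmodule.Build R (coind R)
  coind_scaleA coind_scale1 coind_scaleDr coind_scaleDl.

(** One half of the adjunction Hom_Z(M, Q/Z) = Hom_R(M, [coind R]), whose inverse is evaluation at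
    1. It transfers injectivity and cogeneration from Q/Z to [coind R]. *)
Lemma coind_linear M (chi : {additive M -> QmodZ}) :
  exists k : {linear M -> coind R},
    forall x r, (k x : {additive R -> QmodZ}) r = chi (r *: x).
Proof.
have chiB x : zmod_morphism (fun r : R => chi (r *: x)).
  by move=> a b; rewrite scalerBl raddfB.
have k_lin : linear (fun x => mk_additive (chiB x) : coind R).
  move=> a x y; apply: additive_ext => r /=.
  by rewrite scalerDr raddfD scalerA.
by exists (mk_linear k_lin).
Qed.

Lemma coind_injective : injective_module (coind R : lmodType R).
Proof.
move=> A B f h f_inj.
have chiB : zmod_morphism (fun x => (h x : {additive R -> QmodZ}) 1).
  by move=> x y; rewrite raddfB.
have [|psi psiP] := @char_extend A B f (mk_additive chiB).
  by move=> x; rewrite -(raddf0 f) => /f_inj -> /=; rewrite raddf0.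
have [k kE] := coind_linear psi; exists k => x; apply: additive_ext => r.
by rewrite kE -linearZZ psiP /= linearZZ /= mul1r.
Qed.

(** A power of [coind R] into which [N] embeds by evaluation; no minimality is claimed. Being
    explicit, it makes [cosyz] a function of [N], which [extv] iterates. *)
Definition inj_hull N : lmodType R := {linear N -> coind R} -> coind R.

Fact inj_hull_map_linear N : linear (fun x (h : {linear N -> coind R}) => h x).
Proof. by move=> a x y; apply: funext => h; rewrite linearP. Qed.
Definition inj_hull_map N : {linear N -> inj_hull N} :=
  mk_linear (@inj_hull_map_linear N).

Lemma inj_hull_mapE N x h : inj_hull_map N x h = h x.
Proof. by []. Qed.

Lemma inj_hull_map_inj N : injective (inj_hull_map N).
Proof.
apply: linear_inj => x x0; apply/eqP/negPn/negP => xN0.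
have [chi chix] := char_neq0 xN0; have [k kE] := coind_linear chi.
have := congr1 (fun F : inj_hull N => (F k : {additive R -> QmodZ}) 1) x0.
by rewrite inj_hull_mapE kE scale1r => chix0; case/eqP: chix; apply: chix0.
Qed.

Definition cosyz N : lmodType R := coker (inj_hull_map N).

Lemma cosyz_exact N : exists I (f : {linear N -> I}) (g : {linear I -> cosyz N}),
  short_exact f g /\ injective_module I.
Proof.
exists (inj_hull N), (inj_hull_map N), (coker_proj _); split.
  exact/short_exact_coker/inj_hull_map_inj.
exact/prod_injective/coind_injective.
Qed.

End Coinduced.

(** * Vanishing of Ext *)

Section Ext.
Variable R : pzRingType.
Implicit Types A B D I K M N P Q W : lmodType R.

(* Ext^1(M, N) = 0, in the form that does not mention any resolution. *)
Definition ext1 M N := forall A B (f : {linear A -> B}) (g : {linear B -> M})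
  (h : {linear A -> N}), short_exact f g -> exists k : {linear B -> N}, forall x, k (f x) = h x.

Section Presentation.
Variables (K P M : lmodType R) (f : {linear K -> P}) (g : {linear P -> M}).
Hypotheses (fg : short_exact f g) (P_proj : projective P).

(** A lift [p : P -> B] of [g] presents [B] as the quotient of [A (+) P] by the pairs
    [(- q y, f y)], and [h + k] vanishes on these. *)
Lemma ext1_proj N :
  (forall h : {linear K -> N}, exists k : {linear P -> N}, forall x, k (f x) = h x) ->
  ext1 M N.
Proof.
move=> KN A B u v h uv.
have [p vp] := P_proj g (short_exact_surj uv).
have [q uq] : exists q : {linear K -> A}, forall x, u (q x) = p (f x).
  apply: (short_exact_lift uv (h := p \o f)) => x /=.
  by rewrite vp (short_exact_comp fg).
have [k kf] := KN (h \o q).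
pose s : {linear (A * P)%type -> B} := (u \o fst) \+ (p \o snd).
pose t : {linear (A * P)%type -> N} := (h \o fst) \+ (k \o snd).
have [b|[a x] /= s0|l lE] := @linear_desc _ _ _ _ s t.
- have [x gx] := short_exact_surj fg (v b).
  have /(short_exact_im uv)[a ua] : v (b - p x) = 0 by rewrite linearB vp gx subrr.
  by exists (a, x); rewrite /s /= ua addrNK.
- have /(short_exact_im fg)[y xE] : g x = 0.
    by rewrite -vp -[p x](addKr (u a)) s0 addr0 linearN (short_exact_comp uv) oppr0.
  rewrite /t /= -xE kf /= -linearD; rewrite -xE -uq -linearD in s0.
  by rewrite (short_exact_inj uv (etrans s0 (esym (linear0 u)))) linear0.
- by exists l => a; move: (lE (a, 0)); rewrite /s /t /= !linear0 !addr0.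
Qed.

End Presentation.

(** Exactness of Hom(M, I) -> Hom(M, Q) -> Ext^1(M, K). The pullback [kernel d] of [g] along [h] is
    an extension of [M] by [K]; extending [u] to a map [v] on it corrects the first projection to a
    map [w] that kills [kernel c], hence descends to [M]. *)
Lemma ext1_lift K I Q M (f : {linear K -> I}) (g : {linear I -> Q}) :
  short_exact f g -> ext1 M K ->
  forall h : {linear M -> Q}, exists k : {linear M -> I}, forall x, g (k x) = h x.
Proof.
move=> fg MK h.
pose d : {linear (I * M)%type -> Q} := (g \o fst) \- (h \o snd).
pose c : {linear kernel d -> M} := snd \o ker_incl d.
have dE z : d z = g z.1 - h z.2 by [].
have cE z : c z = (ker_incl d z).2 by [].
have c_surj : surjective c.
  move=> m; have [x gx] := short_exact_surj fg (h m).
  have /ker_incl_exact [z zE] : d (x, m) = 0 by rewrite dE gx subrr.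
  by exists z; rewrite cE zE.
have zd z : g (ker_incl d z).1 = h (ker_incl d z).2.
  by apply/eqP; rewrite -subr_eq0 -dE; apply/eqP/ker_incl_exact; exists z.
have [u uE] : exists u : {linear kernel c -> K},
    forall z, f (u z) = (ker_incl d (ker_incl c z)).1.
  apply: (short_exact_lift fg (h := fst \o (ker_incl d \o ker_incl c))) => z /=.
  by rewrite zd -cE (_ : c _ = 0) ?linear0 //; apply/ker_incl_exact; exists z.
have [v vE] := MK _ _ _ _ u (short_exact_ker c_surj).
pose w : {linear kernel d -> I} := (fst \o ker_incl d) \- (f \o v).
have [|z cz|k kE] := @linear_desc _ _ _ _ c w; first exact: c_surj.
  have /ker_incl_exact [y zE] := cz.
  by rewrite /w /= -zE vE uE subrr.
exists k => m; have [z <-] := c_surj m.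
by rewrite kE /w /= linearB (short_exact_comp fg) subr0 zd.
Qed.

(** Dual to [ext1_proj]: [f \o h] extends to [k] by injectivity, [g \o k] induces [l] on [M], and
    subtracting a lift of [l] from [k] gives a map into [N]. *)
Lemma ext1_inj I Q M N (f : {linear N -> I}) (g : {linear I -> Q}) :
  short_exact f g -> injective_module I ->
  (forall h : {linear M -> Q}, exists k : {linear M -> I}, forall x, g (k x) = h x) ->
  ext1 M N.
Proof.
move=> fg I_inj MQ A B u v h uv.
have [k ku] := I_inj _ _ u (f \o h) (short_exact_inj uv).
have [l lv] : exists l : {linear M -> Q}, forall x, l (v x) = g (k x).
  by apply: (short_exact_desc uv (h := g \o k)) => x /=; rewrite ku /= (short_exact_comp fg).
have [t tl] := MQ l.
have [s sE] : exists s : {linear B -> N}, forall x, f (s x) = k x - t (v x).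
  apply: (short_exact_lift fg (h := k \- (t \o v))) => x /=.
  by rewrite linearB tl lv subrr.
exists s => x; apply: (short_exact_inj fg).
by rewrite sE (short_exact_comp uv) linear0 subr0 ku.
Qed.

(** Both sides say that Ext^2(M, N) = 0. *)
Lemma ext1_shift K P M N I Q (f : {linear K -> P}) (g : {linear P -> M})
    (u : {linear N -> I}) (v : {linear I -> Q}) :
  short_exact f g -> projective P -> short_exact u v -> injective_module I ->
  ext1 K N <-> ext1 M Q.
Proof.
move=> fg P_proj uv I_inj; split=> [KN|MQ].
  apply: (ext1_proj fg P_proj) => h.
  have [k kh] := ext1_lift uv KN h.
  have [l lk] := I_inj _ _ f k (short_exact_inj fg).
  by exists (v \o l) => x /=; rewrite lk kh.
apply: (ext1_inj uv I_inj) => h.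
have [k kf] := MQ _ _ _ _ h fg.
have [l vl] := P_proj _ _ v k (short_exact_surj uv).
by exists (l \o f) => x /=; rewrite vl kf.
Qed.

Lemma injective_ext1 M N : injective_module N -> ext1 M N.
Proof. by move=> N_inj A B f g h /short_exact_inj/N_inj; apply. Qed.

(* Ext^{n+1}(M, N) = 0, by dimension shifting along an injective coresolution
   of N. *)
Definition extv n M N := ext1 M (iter n (@cosyz R) N).

Lemma extvSr n M N : extv n.+1 M N <-> extv n M (cosyz N).
Proof. by rewrite /extv iterSr. Qed.

Lemma extv_syz n K P M N (f : {linear K -> P}) (g : {linear P -> M}) :
  short_exact f g -> projective P -> extv n K N <-> extv n.+1 M N.
Proof.
move=> fg P_proj; rewrite /extv iterS.
have [I [i [p [NI I_inj]]]] := cosyz_exact (iter n (@cosyz R) N).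
exact: ext1_shift fg P_proj NI I_inj.
Qed.

Section Resolution.
Variables (M : lmodType R) (X : resolution M).

Let K : lmodType R := kernel (res_aug X).

Lemma resolution_syz : exists p : {linear X 1%N -> K},
  surjective p /\ forall x, ker_incl (res_aug X) (p x) = res_d X 0 x.
Proof.
have XK := short_exact_ker (res_aug_surj X).
have [|p pE] := short_exact_lift XK (h := res_d X 0).
  by move=> x; apply/res_exact0; exists x.
exists p; split=> // y.
have /res_exact0[x xE] : res_aug X (ker_incl (res_aug X) y) = 0.
  exact: short_exact_comp XK _.
by exists x; apply: (short_exact_inj XK); rewrite pE.
Qed.

(** The tail of [X] resolves the first syzygy. Only positive degrees of [Y] are compared: in degree
    0 [hom_acyclic] asks for [f = 0], not for a factorization. *)
Lemma shift_resolution : exists Y : resolution K,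
  (forall n, Y n = X n.+1) /\
  (proj_resolution X -> proj_resolution Y) /\
  (forall N n, hom_acyclic Y N n.+1 <-> hom_acyclic X N n.+2).
Proof.
have XK := short_exact_ker (res_aug_surj X).
have [p [p_surj pE]] := resolution_syz.
have p_exact : exact_at (res_d X 1) p.
  move=> y; split=> [py|/res_exactS y0].
    by apply/res_exactS; rewrite -pE py linear0.
  by apply: (short_exact_inj XK); rewrite pE y0 linear0.
exists (@Resolution R K (fun n => X n.+1) (fun n => res_d X n.+1) p p_surj p_exact
  (fun n => @res_exactS R M X n.+1)).
by do ![split=> //] => X_proj n; apply: X_proj.
Qed.

(** A cocycle on [X 1] is a map on the syzygy [K] composed with [p], and it is a coboundary exactly
    when that map extends to [X 0]. *)
Lemma hom_acyclic1 N : projective (X 0%N) -> hom_acyclic X N 1 <-> ext1 M N.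
Proof.
move=> X_proj; have XK := short_exact_ker (res_aug_surj X).
have [p [p_surj pE]] := resolution_syz; split=> [XN|MN].
  apply: (ext1_proj XK X_proj) => h.
  have [|k kE] := XN (h \o p).
    move=> x /=; rewrite (_ : p _ = 0) ?linear0 //; apply: (short_exact_inj XK).
    by rewrite pE linear0; apply/res_exactS; exists x.
  by exists k => y; have [x <-] := p_surj y; rewrite pE -kE.
move=> f f0; have [//|x|k kE] := @linear_desc _ _ _ _ p f.
  move=> /(congr1 (ker_incl (res_aug X))); rewrite pE linear0.
  by move=> /res_exactS [y <-].
have [l lE] := MN _ _ _ _ k XK.
by exists l => x; rewrite -pE lE kE.
Qed.

End Resolution.

Lemma hom_acyclicE M (X : resolution M) N n : proj_resolution X ->
  hom_acyclic X N n.+1 <-> extv n M N.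
Proof.
elim: n M X => [|n IHn] M X X_proj; first exact: hom_acyclic1.
have [Y [_ [Y_proj YX]]] := shift_resolution X.
rewrite -YX IHn; last exact: Y_proj.
exact: extv_syz (short_exact_ker (res_aug_surj X)) (X_proj 0%N).
Qed.

(** [hom_acyclicE] holds for each projective resolution, and [proj_resolution_exists] keeps the
    quantification over them from being vacuous. *)
Lemma Ext_vanishesE M N n : Ext_vanishes n.+1 M N <-> extv n M N.
Proof.
split=> [MN|MN X X_proj]; last exact/hom_acyclicE.
have [X X_proj] := proj_resolution_exists M.
exact/(hom_acyclicE _ _ X_proj)/MN.
Qed.

Lemma Ext_vanishes_ge1 M N :
  (forall i, (1 <= i)%N -> Ext_vanishes i M N) <-> (forall n, extv n M N).
Proof.
by split=> [MN n|MN [//|n] _]; [apply/Ext_vanishesE/MN|apply/Ext_vanishesE].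
Qed.

Lemma enough_projectives M : exists K P (f : {linear K -> P}) (g : {linear P -> M}),
  short_exact f g /\ projective P.
Proof.
have [X X_proj] := proj_resolution_exists M.
exists (kernel (res_aug X)), (X 0%N), (ker_incl _), (res_aug X).
by split=> //; apply/short_exact_ker/res_aug_surj.
Qed.

(** Puts the dimension shift in the first variable. This is the form suited to exact sequences,
    retracts and products in the second variable, since no exact sequence between the modules
    [cosyz] of its terms is at hand. *)
Lemma syzygy M n : exists K, forall N, ext1 K N <-> extv n M N.
Proof.
elim: n M => [|n IHn] M; first by exists M.
have [K [P [f [g [fg P_proj]]]]] := enough_projectives M.
have [L LE] := IHn K; exists L => N; rewrite LE; exact: extv_syz fg P_proj.
Qed.

(** ** Long exact sequences *)

Section FirstVariable.
Variables (A B D : lmodType R) (f : {linear A -> B}) (g : {linear B -> D}).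
Hypothesis fg : short_exact f g.

(** Exactness of Hom(B, N) -> Hom(A, N) -> Ext^1(D, N) -> Ext^1(B, N); the extension hypothesis
    makes the connecting map vanish. In [ext1_cokerS] it comes from Ext^1(A, N) = 0, because a map
    to [cosyz N] then lifts to an injective module. *)
Lemma ext1_coker N :
  (forall h : {linear A -> N}, exists k : {linear B -> N}, forall x, k (f x) = h x) ->
  ext1 B N -> ext1 D N.
Proof.
move=> AN BN; have [I [i [p [NI I_inj]]]] := cosyz_exact N.
apply: (ext1_inj NI I_inj) => h.
have [u uE] := ext1_lift NI BN (h \o g).
have [s sE] : exists s : {linear A -> N}, forall x, i (s x) = u (f x).
  apply: (short_exact_lift NI (h := u \o f)) => x /=.
  by rewrite uE /= (short_exact_comp fg) linear0.
have [t tE] := AN s.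
have [|k kE] := short_exact_desc fg (h := u \- (i \o t)).
  by move=> x /=; rewrite tE sE subrr.
exists k => y; have [x <-] := short_exact_surj fg y.
by rewrite kE /= linearB (short_exact_comp NI) subr0 uE.
Qed.

Lemma ext1_cokerS N : ext1 A N -> ext1 B (cosyz N) -> ext1 D (cosyz N).
Proof.
move=> AN; have [I [i [p [NI I_inj]]]] := cosyz_exact N; apply: ext1_coker => h.
have [k kE] := ext1_lift NI AN h.
have [l lE] := I_inj _ _ f k (short_exact_inj fg).
by exists (p \o l) => x /=; rewrite lE kE.
Qed.

Lemma ext1_kernel N : ext1 B N -> ext1 D (cosyz N) -> ext1 A N.
Proof.
move=> BN DN; have [I [i [p [NI I_inj]]]] := cosyz_exact N.
apply: (ext1_inj NI I_inj) => h.
have [k kE] := DN _ _ _ _ h fg.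
have [l lE] := ext1_lift NI BN k.
by exists (l \o f) => x /=; rewrite lE kE.
Qed.

Lemma ext1_extension N : ext1 A N -> ext1 D N -> ext1 B N.
Proof.
move=> AN DN; have [I [i [p [NI I_inj]]]] := cosyz_exact N.
apply: (ext1_inj NI I_inj) => h.
have [k kE] := ext1_lift NI AN (h \o f).
have [l lE] := I_inj _ _ f k (short_exact_inj fg).
have [|t tE] := short_exact_desc fg (h := h \- (p \o l)).
  by move=> x /=; rewrite lE kE subrr.
have [u uE] := ext1_lift NI DN t.
by exists (l \+ (u \o g)) => x /=; rewrite linearD [X in _ + X]uE tE /= addrCA subrr addr0.
Qed.

Lemma extv_kernel n N : extv n B N -> extv n.+1 D N -> extv n A N.
Proof. exact: ext1_kernel. Qed.
Lemma extv_extension n N : extv n A N -> extv n D N -> extv n B N.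
Proof. exact: ext1_extension. Qed.
Lemma extv_cokerS n N : extv n A N -> extv n.+1 B N -> extv n.+1 D N.
Proof. exact: ext1_cokerS. Qed.

(** Exactness of Hom(M, B) -> Hom(M, D) -> Ext^1(M, A) -> Ext^1(M, B), the lifting hypothesis again
    standing for the vanishing of the connecting map. *)
Lemma ext1_ker_r M : (forall h : {linear M -> D}, exists k : {linear M -> B},
    forall x, g (k x) = h x) -> ext1 M B -> ext1 M A.
Proof.
move=> MD MB U V u v h uv.
have [k kE] := MB _ _ _ _ (f \o h) uv.
have [|l lE] := short_exact_desc uv (h := g \o k).
  by move=> x /=; rewrite kE /= (short_exact_comp fg).
have [t tE] := MD l.
have [|s sE] := short_exact_lift fg (h := k \- (t \o v)).
  by move=> x /=; rewrite linearB tE lE subrr.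
exists s => x; apply: (short_exact_inj fg).
by rewrite sE /= (short_exact_comp uv) linear0 subr0 kE.
Qed.

Lemma ext1_ext_r M : ext1 M A -> ext1 M D -> ext1 M B.
Proof.
move=> MA MD; have [K [P [u [v [uv P_proj]]]]] := enough_projectives M.
apply: (ext1_proj uv P_proj) => h.
have [k kE] := MD _ _ _ _ (g \o h) uv.
have [l lE] := P_proj _ _ g k (short_exact_surj fg).
have [|t tE] := short_exact_lift fg (h := h \- (l \o u)).
  by move=> x /=; rewrite linearB lE kE subrr.
have [s sE] := MA _ _ _ _ t uv.
by exists ((f \o s) \+ l) => x /=; rewrite sE tE /= subrK.
Qed.

Lemma extv_ext_r n M : extv n M A -> extv n M D -> extv n M B.
Proof. by have [K KE] := syzygy M n; rewrite -!KE; apply: ext1_ext_r. Qed.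

Lemma extv_coker_r n M : extv n M B -> extv n.+1 M A -> extv n M D.
Proof.
have [K KE] := syzygy M n; rewrite extvSr -!KE => KB KA.
have [L [P [u [v [uv P_proj]]]]] := enough_projectives K.
have LA : ext1 L A.
  have [I [i [p [AI I_inj]]]] := cosyz_exact A.
  exact/(ext1_shift uv P_proj AI I_inj).
apply: (ext1_proj uv P_proj) => h.
have [k kE] := ext1_lift fg LA h.
have [l lE] := KB _ _ _ _ k uv.
by exists (g \o l) => x /=; rewrite lE kE.
Qed.

Lemma extvS_ker_r n M : extv n M D -> extv n.+1 M B -> extv n.+1 M A.
Proof.
have [K KE] := syzygy M n; rewrite !extvSr -!KE => KD KB.
have [L [P [u [v [uv P_proj]]]]] := enough_projectives K.
have shift N : ext1 L N <-> ext1 K (cosyz N).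
  have [I [i [p [NI I_inj]]]] := cosyz_exact N; exact: ext1_shift uv P_proj NI I_inj.
rewrite -!shift in KB *; apply: ext1_ker_r KB => h.
have [k kE] := KD _ _ _ _ h uv.
have [l lE] := P_proj _ _ g k (short_exact_surj fg).
by exists (l \o u) => x /=; rewrite lE kE.
Qed.

End FirstVariable.

End Ext.

(** * Retracts, products and vanishing of Ext *)

Section Retract.
Variable R : pzRingType.
Implicit Types M N L : lmodType R.

Lemma extv_retract_l n M L N : retract M L -> extv n L N -> extv n M N.
Proof.
move=> [i [r ir]] LN; rewrite /extv in LN *; set N' := iter _ _ _ in LN *.
have [I [f [g [NI I_inj]]]] := cosyz_exact N'.
apply: (ext1_inj NI I_inj) => h; have [k kE] := ext1_lift NI LN (h \o r).
by exists (k \o i) => x /=; rewrite kE /= ir.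
Qed.

Lemma extv_retract_r n M N L : retract N L -> extv n M L -> extv n M N.
Proof.
move=> [i [r ir]]; have [K KE] := syzygy M n; rewrite -!KE => KL A B f g h fg.
have [k kE] := KL _ _ _ _ (i \o h) fg.
by exists (r \o k) => x /=; rewrite kE /= ir.
Qed.

Lemma extv_prod n (I : Type) M N :
  extv n M N -> extv n M ((I -> N) : lmodType R).
Proof.
have [K KE] := syzygy M n; rewrite -!KE => KN A B f g h fg.
have h_lin i : linear (fun x => h x i) by move=> a x y; rewrite linearP.
have /choice [k kf] i := KN _ _ _ _ (mk_linear (h_lin i)) fg.
have k_lin : linear (fun x i => k i x).
  by move=> a x y; apply: funext => i; rewrite linearP.
by exists (mk_linear k_lin) => x; apply: funext => i; apply: kf.
Qed.

Lemma injective_extv n M N : injective_module N -> extv n M N.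
Proof. by have [K KE] := syzygy M n; rewrite -KE; apply: injective_ext1. Qed.

End Retract.

(** * Direct sums *)

Section DirectSum.
Local Open Scope classical_set_scope.
Variable I : Type.

Section Additive.
Variable V : zmodType.

Fact dsum_in_subproof (i : I) (v : V) :
  (fun j => if `[< j = i >] then v else 0) \in @fin_support I V.
Proof.
apply/asboolP; apply: (sub_finite_set _ (finite_set1 i)) => j /=.
by case: asboolP => // _ /eqP.
Qed.

Definition dsum_in_fun i v : dsum I V := DSum (dsum_in_subproof i v).

Lemma dsum_inB i : zmod_morphism (dsum_in_fun i).
Proof.
move=> x y; apply/val_inj/funext => j /=; rewrite !fctE /=.
by case: asboolP; rewrite ?subrr.
Qed.

Definition dsum_in i : {additive V -> dsum I V} := mk_additive (@dsum_inB i).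

Lemma dsum_inE i v j : dsum_in i v j = if `[< j = i >] then v else 0.
Proof. by []. Qed.

(** The index type is arbitrary; finite sets of indices require a choice structure, which is
    supplied classically on a type convertible to [I]. *)
Let J : choiceType := {classic I}.
Let supp (x : dsum I V) : set J := [set i | x i != 0].

Let supp_fin x : finite_set (supp x).
Proof. by have /asboolP := valP x. Qed.

Section Elimination.
Variables (N : zmodType) (u : I -> {additive V -> N}).

Definition dsum_elim_fun x : N := \sum_(i <- fset_set (supp x)) u i (x i).

Let elimE (A : {fset J}) x :
  supp x `<=` [set` A] -> dsum_elim_fun x = \sum_(i <- A) u i (x i).
Proof.
move=> sA; apply: big_fset_incl => [|i _].
  by apply/fsubsetP => i; rewrite in_fset_set // inE => /sA.
rewrite in_fset_set // notin_setE /= => /negP; rewrite negbK => /eqP ->.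
by rewrite raddf0.
Qed.

Lemma dsum_elimB : zmod_morphism dsum_elim_fun.
Proof.
move=> x y; pose A := (fset_set (supp x) `|` fset_set (supp y))%fset.
have sx : supp x `<=` [set` A].
  by move=> i xi; rewrite /= in_fsetU in_fset_set ?mem_set.
have sy : supp y `<=` [set` A].
  by move=> i yi; rewrite /= in_fsetU orbC in_fset_set ?mem_set.
have sxy : supp (x - y) `<=` [set` A].
  move=> i; have [xi _|] := boolP (x i != 0); first exact: (sx i xi).
  rewrite negbK => /eqP xi; have [yi _|] := boolP (y i != 0); first exact: (sy i yi).
  rewrite negbK => /eqP yi; rewrite /supp /= [X in X != 0](_ : _ = x i - y i) //.
  by rewrite xi yi subrr eqxx.
rewrite !(@elimE A) // -sumrB; apply: eq_bigr => i _.
by rewrite -raddfB.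
Qed.

Definition dsum_elim : {additive dsum I V -> N} := mk_additive dsum_elimB.

Lemma dsum_elim_in i v : dsum_elim (dsum_in i v) = u i v.
Proof.
rewrite [LHS](@elimE [fset (i : J)]%fset) ?big_seq_fset1 ?dsum_inE.
  by case: asboolP.
by move=> j; rewrite /supp /= inE; case: asboolP => [->|_] /eqP.
Qed.

End Elimination.

Lemma dsum_ind (P : dsum I V -> Prop) : P 0 ->
  (forall x y, P x -> P y -> P (x + y)) -> (forall i v, P (dsum_in i v)) ->
  forall x, P x.
Proof.
move=> P0 PD Pin x; suff -> : x = dsum_elim dsum_in x by apply: big_rec => // i y _; apply: PD.
apply/val_inj/funext => j; pose ev := fun y : dsum I V => y j.
have ev_sum A : ev (\sum_(i <- A) dsum_in i (x i)) = \sum_(i <- A) ev (dsum_in i (x i)).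
  by elim/big_ind2: _ => // _ a _ b <- <-.
rewrite [RHS]ev_sum /ev /=.
have [xj|/negbNE/eqP xj] := boolP (x j != 0).
  rewrite (bigD1_seq (j : J)) ?fset_uniq ?in_fset_set ?mem_set //=.
  rewrite asboolT // big1 ?addr0 // => i /eqP ij.
  by case: asboolP => // /esym.
rewrite xj big1 // => i _; by case: asboolP => // <-.
Qed.

Lemma dsum_additive_ext (N : zmodType) (f g : {additive dsum I V -> N}) :
  (forall i v, f (dsum_in i v) = g (dsum_in i v)) -> f =1 g.
Proof.
by move=> fg; elim/dsum_ind => // [|x y fgx fgy]; rewrite ?raddf0 ?raddfD ?fgx ?fgy.
Qed.

End Additive.

Arguments dsum_in {V}.

Section Linear.
Variables (R : pzRingType) (V N : lmodType R).

Lemma dsum_inZ i (a : R) (v : V) : dsum_in i (a *: v) = a *: dsum_in i v.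
Proof.
by apply/val_inj/funext => j /=; rewrite !fctE /=; case: asboolP; rewrite ?scaler0.
Qed.

Lemma dsum_in_linear i : linear (dsum_in i : V -> dsum I V).
Proof. by move=> a x y; rewrite raddfD dsum_inZ. Qed.
Definition dsum_inl i : {linear V -> dsum I V} := mk_linear (dsum_in_linear i).

Lemma dsum_linear (u : I -> {linear V -> N}) :
  exists k : {linear dsum I V -> N}, forall i v, k (dsum_in i v) = u i v.
Proof.
pose k := dsum_elim (fun i => u i : {additive V -> N}).
have k_lin : linear k.
  move=> a x y; rewrite raddfD; congr (_ + _); elim/dsum_ind: x => [|x x' xE xE'|i v].
  - by rewrite scaler0 raddf0 scaler0.
  - by rewrite scalerDr !raddfD xE xE'.
  - by rewrite -dsum_inZ !dsum_elim_in; exact: linearZZ.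
by exists (mk_linear k_lin) => i v; apply: dsum_elim_in.
Qed.

End Linear.

Lemma extv_dsum (R : pzRingType) (V N : lmodType R) n :
  extv n V N -> extv n (dsum I V) N.
Proof.
rewrite /extv; set N' := iter _ _ _ => VN.
have [Q [f [g [NQ Q_inj]]]] := cosyz_exact N'.
apply: (ext1_inj NQ Q_inj) => h.
have /choice [k kE] i := ext1_lift NQ VN (h \o dsum_inl V i).
have [l lE] := dsum_linear k; exists l.
apply: (@dsum_additive_ext _ _ (g \o l) h) => i v /=.
by rewrite lE kE.
Qed.

End DirectSum.

Arguments dsum_in {I V} i.
Arguments dsum_inl {I R} V i.

(** * Character modules and tensor products *)

Local Notation ch phi := (phi : {additive _ -> QmodZ}).

Section CharacterMap.
Variable R : pzRingType.
Implicit Types A B D : lmodType R.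

Definition charg_map_fun A B (g : {linear A -> B}) (phi : charg B) : charg A :=
  ch phi \o g.

Fact charg_map_linear A B (g : {linear A -> B}) : linear (charg_map_fun g).
Proof. by move=> a phi psi; apply: additive_ext => x /=; rewrite linearZZ. Qed.
Definition charg_map A B (g : {linear A -> B}) : {linear charg B -> charg A} :=
  mk_linear (charg_map_linear g).

Lemma charg_mapE A B (g : {linear A -> B}) phi x : ch (charg_map g phi) x = ch phi (g x).
Proof. by []. Qed.

Lemma charg_exact A B D (f : {linear A -> B}) (g : {linear B -> D}) :
  short_exact f g -> short_exact (charg_map g) (charg_map f).
Proof.
move=> fg; split.
- apply: linear_inj => phi phi0; apply: additive_ext => y.
  have [x <-] := short_exact_surj fg y.
  by rewrite -charg_mapE phi0.
- move=> phi; split=> [phi0|[psi <-]]; last first.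
    by apply: additive_ext => x; rewrite !charg_mapE (short_exact_comp fg) raddf0.
  have [|psi psiE] := @char_extend _ _ g (ch phi).
    by move=> x /(short_exact_im fg)[y <-]; rewrite -charg_mapE phi0.
  by exists psi; apply: additive_ext.
- move=> phi; have [|psi psiE] := @char_extend _ _ f (ch phi).
    by move=> x; rewrite -(linear0 f) => /(short_exact_inj fg) ->; rewrite raddf0.
  by exists psi; apply: additive_ext.
Qed.

Lemma retract_charg A B : retract A B -> retract (charg A : lmodType R^c) (charg B).
Proof.
move=> [i [r ir]]; exists (charg_map r), (charg_map i) => phi.
by apply: additive_ext => x; rewrite !charg_mapE ir.
Qed.

End CharacterMap.

(** One direction is the injectivity of Q/Z; in the other, an element of the kernel of [g] outside
    the image of [f] would be detected by a character killing that image. *)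
Lemma exact_char (A B D : zmodType) (f : {additive A -> B}) (g : {additive B -> D}) :
  (forall x, g (f x) = 0) ->
  exact_at f g <->
  (forall chi : {additive B -> QmodZ}, (forall x, chi (f x) = 0) ->
     exists psi : {additive D -> QmodZ}, forall y, chi y = psi (g y)).
Proof.
move=> gf0; split=> [fg chi chi0|fg y].
  have [|psi psiE] := @char_extend _ _ g chi; last by exists psi.
  by move=> y /fg[x <-].
split=> [gy|[x <-] //]; apply: contrapT => /char_separate [chi chi0].
by have [psi ->] := fg chi chi0; rewrite gy raddf0 eqxx.
Qed.

Lemma injective_char (A B : zmodType) (f : {additive A -> B}) :
  (forall chi : {additive A -> QmodZ}, exists psi : {additive B -> QmodZ},
    forall x, chi x = psi (f x)) -> injective f.
Proof.
move=> f_ext x y /eqP; rewrite -subr_eq0 -raddfB => /eqP fxy.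
apply/eqP; rewrite -subr_eq0; apply/negPn/negP => /char_neq0[chi].
by have [psi ->] := f_ext chi; rewrite fxy raddf0 eqxx.
Qed.

Section TensorHom.
Variable R : pzRingType.
Implicit Types (M : lmodType R^c) (N : lmodType R).

Lemma tensorDl M N (m m' : M) (n : N) : tensor (m + m') n = tensor m n + tensor m' n.
Proof. by have [tD _ _] := tensor_balanced M N; apply: tD. Qed.
Lemma tensorDr M N (m : M) (n n' : N) : tensor m (n + n') = tensor m n + tensor m n'.
Proof. by have [_ tD _] := tensor_balanced M N; apply: tD. Qed.
Lemma tensorZ M N (m : M) (r : R) (n : N) : tensor ((r : R^c) *: m) n = tensor m (r *: n).
Proof. by have [_ _ tZ] := tensor_balanced M N; apply: tZ. Qed.

Lemma tens_additive (A : zmodType) M N (b : M -> N -> A) : balanced b ->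
  exists k : {additive tens M N -> A}, forall m n, k (tensor m n) = b m n.
Proof.
move=> b_bal; exists (mk_additive (tens_lift_zmod b_bal)) => m n.
exact: tens_lift_tensor.
Qed.

Lemma tens_additive_ext (A : zmodType) M N (f g : {additive tens M N -> A}) :
  (forall m n, f (tensor m n) = g (tensor m n)) -> f =1 g.
Proof. by apply: tens_ext => x y; rewrite raddfB. Qed.

(* The next two lemmas are the adjunction Hom(M (x) N, Q/Z) = Hom_R(M, N^+). *)
Lemma tens_char_of M N (phi : {linear M -> charg N}) :
  exists chi : {additive tens M N -> QmodZ},
    forall m n, chi (tensor m n) = ch (phi m) n.
Proof.
apply: tens_additive; split=> [n m m'|m n n'|m r n]; first by rewrite linearD.
  by rewrite raddfD.
by rewrite linearZZ.
Qed.

Lemma tens_hom_of M N (chi : {additive tens M N -> QmodZ}) :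
  exists phi : {linear M -> charg N}, forall m n, ch (phi m) n = chi (tensor m n).
Proof.
have chiB m : zmod_morphism (fun n => chi (tensor m n)).
  move=> n n'; rewrite -raddfB; congr (chi _).
  by apply/eqP; rewrite eq_sym subr_eq -tensorDr subrK.
have phi_lin : linear (fun m => mk_additive (chiB m) : charg N).
  move=> a m m'; apply: additive_ext => n /=.
  by rewrite tensorDl raddfD tensorZ.
by exists (mk_linear phi_lin).
Qed.

Lemma tens_mapl_zmod M M' (f : {linear M -> M'}) N : zmod_morphism (@tens_mapl _ _ _ f N).
Proof.
apply: tens_lift_zmod; split=> [n m m'|m n n'|m r n].
- by rewrite linearD tensorDl.
- exact: tensorDr.
- by rewrite linearZZ tensorZ.
Qed.
Definition tens_map1 M M' (f : {linear M -> M'}) N : {additive tens M N -> tens M' N} :=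
  mk_additive (tens_mapl_zmod f (N := N)).

Fact tens_map2_bal M N N' (f : {linear N -> N'}) :
  balanced (fun m n => tensor m (f n) : tens M N').
Proof.
split=> [n m m'|m n n'|m r n].
- exact: tensorDl.
- by rewrite linearD tensorDr.
- by rewrite linearZZ tensorZ.
Qed.
Definition tens_map2 M N N' (f : {linear N -> N'}) : {additive tens M N -> tens M N'} :=
  mk_additive (tens_lift_zmod (tens_map2_bal M f)).

Lemma tens_map1E M M' (f : {linear M -> M'}) N m n :
  tens_map1 f N (tensor m n) = tensor (f m) n.
Proof. exact: tens_mapl_tensor. Qed.

Lemma tens_map2E M N N' (f : {linear N -> N'}) m n :
  tens_map2 M f (tensor m n) = tensor m (f n).
Proof. exact: (tens_lift_tensor (tens_map2_bal M f)). Qed.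

(** Characters of M (x) N are maps M -> N^+, so testing exactness on characters turns the tensored
    complex into a Hom complex. This is Tor_i(M, N)^+ = Ext^i(M, N^+) at the level of complexes. *)
Lemma hom_char_exact M M' M'' N (f : {linear M -> M'}) (g : {linear M' -> M''}) :
  (forall m, g (f m) = 0) ->
  exact_at (tens_map1 f N) (tens_map1 g N) <->
  (forall h : {linear M' -> charg N}, (forall m, h (f m) = 0) ->
     exists k : {linear M'' -> charg N}, forall m, h m = k (g m)).
Proof.
move=> gf; rewrite exact_char; last first.
  move=> x; apply: (@tens_additive_ext _ _ _ (tens_map1 g N \o tens_map1 f N) \0) => m n /=.
  rewrite !tens_mapl_tensor gf.
  by apply/eqP; rewrite -(addrK (tensor 0 n) (tensor 0 n)) -tensorDl addr0 subrr.
split=> [ex h hf|ex chi chif].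
  have [chi chiE] := tens_char_of h.
  have [x|psi psiE] := ex chi.
    apply: (@tens_additive_ext _ _ _ (chi \o tens_map1 f N) \0) => m n /=.
    by rewrite tens_mapl_tensor chiE hf.
  have [k kE] := tens_hom_of psi; exists k => m; apply: additive_ext => n.
  by rewrite kE -chiE psiE tens_map1E.
have [h hE] := tens_hom_of chi; have [m|k kE] := ex h.
  by apply: additive_ext => n; rewrite hE -tens_map1E chif.
have [psi psiE] := tens_char_of k; exists psi.
apply: (@tens_additive_ext _ _ _ chi (psi \o tens_map1 g N)) => m n /=.
by rewrite -hE kE tens_mapl_tensor psiE.
Qed.

Lemma Tor_vanishesE n M N : Tor_vanishes n.+1 M N <-> extv n M (charg N).
Proof.
have TE (X : resolution M) : tens_acyclic X N n.+1 <-> hom_acyclic X (charg N) n.+1.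
  by apply: hom_char_exact => m; apply/res_exactS; exists m.
rewrite -Ext_vanishesE.
by split=> MN X /MN; rewrite TE.
Qed.

Lemma Tor_vanishes_ge1 M N :
  (forall i, (1 <= i)%N -> Tor_vanishes i M N) <-> (forall n, extv n M (charg N)).
Proof.
by split=> [MN n|MN [//|n] _]; [apply/Tor_vanishesE/MN|apply/Tor_vanishesE].
Qed.

Lemma tens_map1_surj M M' N (f : {linear M -> M'}) :
  surjective f -> surjective (tens_map1 f N).
Proof.
move=> f_surj y; elim/tens_ind: y => [|_ _ [u <-] [v <-]|m n].
- by exists 0; rewrite raddf0.
- by exists (u - v); rewrite raddfB.
- by have [m' <-] := f_surj m; exists (tensor m' n); rewrite tens_map1E.
Qed.

Lemma tens_map2_surj M N N' (f : {linear N -> N'}) :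
  surjective f -> surjective (tens_map2 M f).
Proof.
move=> f_surj y; elim/tens_ind: y => [|_ _ [u <-] [v <-]|m n].
- by exists 0; rewrite raddf0.
- by exists (u - v); rewrite raddfB.
- by have [n' <-] := f_surj n; exists (tensor m n'); rewrite tens_map2E.
Qed.

(** Right exactness of the tensor product is left exactness of Hom(-, N^+) seen through
    characters. *)
Lemma tens_map1_exact M M' M'' N (f : {linear M -> M'}) (g : {linear M' -> M''}) :
  short_exact f g -> exact_at (tens_map1 f N) (tens_map1 g N).
Proof.
move=> fg; apply/hom_char_exact => [m|h hf]; first exact: (short_exact_comp fg).
by have [k kE] := short_exact_desc fg hf; exists k => m; rewrite kE.
Qed.

Lemma tens_map1_inj M M' N (f : {linear M -> M'}) :
  (forall h : {linear M -> charg N}, exists k : {linear M' -> charg N},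
    forall x, k (f x) = h x) -> injective (tens_map1 f N).
Proof.
move=> f_ext; apply: injective_char => chi; have [h hE] := tens_hom_of chi.
have [k kE] := f_ext h; have [psi psiE] := tens_char_of k; exists psi.
apply: (@tens_additive_ext _ _ _ chi (psi \o tens_map1 f N)) => m n /=.
by rewrite -hE tens_mapl_tensor psiE kE.
Qed.

Lemma tens_map2_exact M N N' N'' (f : {linear N -> N'}) (g : {linear N' -> N''}) :
  short_exact f g -> exact_at (tens_map2 M f) (tens_map2 M g).
Proof.
move=> fg; have fg' := charg_exact fg; apply/exact_char => [x|chi chif].
  apply: (@tens_additive_ext _ _ _ (tens_map2 M g \o tens_map2 M f) \0) => m n /=.
  rewrite !(tens_lift_tensor (tens_map2_bal _ _)) (short_exact_comp fg).
  by apply/eqP; rewrite -(addrK (tensor m 0) (tensor m 0)) -tensorDr addr0 subrr.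
have [h hE] := tens_hom_of chi.
have [|k kE] := short_exact_lift fg' (h := h).
  by move=> m; apply: additive_ext => n; rewrite charg_mapE hE -tens_map2E chif.
have [psi psiE] := tens_char_of k; exists psi.
apply: (@tens_additive_ext _ _ _ chi (psi \o tens_map2 M g)) => m n /=.
by rewrite -hE -kE charg_mapE (tens_lift_tensor (tens_map2_bal _ _)) psiE.
Qed.

(** Together with [tens_map2_ext]: M (x) f is injective iff Hom(M, N'^+) -> Hom(M, N^+) is onto. The
    right-hand side is what [ext1_lift] produces and [ext1_ker_r] consumes, so this is the Tor_1 end
    of the long exact sequence. *)
Lemma tens_map2_inj M N N' (f : {linear N -> N'}) :
  (forall h : {linear M -> charg N}, exists k : {linear M -> charg N'},
    forall x, charg_map f (k x) = h x) -> injective (tens_map2 M f).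
Proof.
move=> f_ext; apply: injective_char => chi; have [h hE] := tens_hom_of chi.
have [k kE] := f_ext h; have [psi psiE] := tens_char_of k; exists psi.
apply: (@tens_additive_ext _ _ _ chi (psi \o tens_map2 M f)) => m n /=.
by rewrite -hE (tens_lift_tensor (tens_map2_bal _ _)) psiE -kE.
Qed.

Lemma tens_map2_ext M N N' (f : {linear N -> N'}) : injective (tens_map2 M f) ->
  forall h : {linear M -> charg N}, exists k : {linear M -> charg N'},
    forall x, charg_map f (k x) = h x.
Proof.
move=> f_inj h; have [chi chiE] := tens_char_of h.
have [|psi psiE] := @char_extend _ _ (tens_map2 M f) chi.
  by move=> x; rewrite -(raddf0 (tens_map2 M f)) => /f_inj ->; rewrite raddf0.
have [k kE] := tens_hom_of psi; exists k => m; apply: additive_ext => n.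
by rewrite charg_mapE kE -tens_map2E psiE chiE.
Qed.

End TensorHom.

(** * Weak AB-contexts *)

(* [ses A B C] stands for the existence of a short exact sequence
   0 -> A -> B -> C -> 0 and [E n A B] for Ext^{n+1}(A, B) = 0.  The structure is
   abstract so that modules and their opposite category are both instances, and
   the left-handed theory is the right-handed one read in the opposite. *)
Record exact_structure (Ob : Type) (ses : Ob -> Ob -> Ob -> Prop)
    (sum : Ob -> Ob -> Ob) (zero : Ob) (E : nat -> Ob -> Ob -> Prop) : Prop :=
  ExactStructure {
  ses_zero : forall A, ses A A zero;
  ses_pullback : forall A B C A' B', ses A B C -> ses A' B' C ->
    exists D, ses A D B' /\ ses A' D B;
  ses_pushout : forall A B C B' C', ses A B C -> ses A B' C' ->
    exists D, ses B' D C /\ ses B D C';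
  ses_quotient : forall A B C D F, ses A B C -> ses B D F ->
    exists V, ses A D V /\ ses C V F;
  ses_preimage : forall A B C D F, ses C B A -> ses F D B ->
    exists V, ses V D A /\ ses F V C;
  ses_split : forall A B C D F, E 0%N C A -> ses A B C -> ses C D F ->
    ses B (sum A D) F;
  ses_summand : forall A A' D F, ses (sum A A') D F ->
    exists K K', [/\ ses A D K, ses A' D K' & ses D (sum K K') F];
  ses_ext : forall n A B C N, ses A B C -> E n B N -> E n.+1 C N -> E n A N
}.

(** * Auslander-Buchweitz theory in an abstract exact structure *)

Section WeakContext.
Variables (Ob : Type) (ses : Ob -> Ob -> Ob -> Prop) (sum : Ob -> Ob -> Ob).
Variables (zero : Ob) (E : nat -> Ob -> Ob -> Prop).
Hypothesis ex : exact_structure ses sum zero E.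

(** A coresolution of length at most [n] cut into short exact sequences, which allows induction on
    [n]; in the opposite structure it is a resolution. *)
Fixpoint coresn (X : Ob -> Prop) n M : Prop :=
  if n is k.+1 then exists W K, [/\ ses M W K, X W & coresn X k K] else X M.

Variables W Y : Ob -> Prop.
Hypothesis W_zero : W zero.
Hypothesis W_sum : forall A B, W (sum A B) <-> W A /\ W B.
(** An [exact_structure] has no isomorphisms, so the splitting of a sequence is recorded only
    through its effect on [W]. *)
Hypothesis W_split : forall A B C, E 0%N C A -> ses A B C -> (W B <-> W A /\ W C).
Hypothesis W_sub_Y : forall A, W A -> Y A.
Hypothesis Y_ext : forall A B C, ses A B C -> Y A -> Y C -> Y B.
Hypothesis W_perp_Y : forall n A B, W A -> Y B -> E n A B.
Hypothesis Y_cover : forall A, Y A -> exists B V, [/\ ses B V A, W V & Y B].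

Lemma coresn_perp k n M N : coresn W n M -> Y N -> E k M N.
Proof.
move=> + YN; elim: n k M => [|n IHn] k M /=; first by move=> WM; apply: W_perp_Y.
move=> [V [K [MVK WV /IHn KN]]]; apply: (ses_ext ex MVK) => //.
exact: W_perp_Y.
Qed.

Lemma coresnS n M : coresn W n M -> coresn W n.+1 M.
Proof.
elim: n M => [|n IHn] M; first by exists M, zero; split=> //; apply: ses_zero ex _.
by move=> [V [K [MVK WV /IHn KN]]]; exists V, K.
Qed.

Lemma coresn_le n m M : (n <= m)%N -> coresn W n M -> coresn W m M.
Proof. by move/subnK <-; elim: (m - n)%N => // k IHk /IHk/coresnS. Qed.

(** Horseshoe argument. The pushout [Z] of [WA] and [B] under [A] is an extension of [C] by [WA]. It
    splits because E(C, WA) = 0, so [Z] embeds in WA (+) WC with cokernel [KC]; the quotient of WA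
    (+) WC by [B] is then an extension of [KC] by [KA], and the induction applies to it. *)
Lemma coresn_ext n A B C : ses A B C -> coresn W n A -> coresn W n C -> coresn W n B.
Proof.
elim: n A B C => [|n IHn] A B C ABC.
  by move=> WA WC; apply/(W_split _ ABC) => //; apply/W_perp_Y/W_sub_Y.
move=> [WA [KA [AWK wA cA]]] cC.
have CA : E 0%N C WA by apply: coresn_perp cC _; apply: W_sub_Y.
case: cC => WC [KC [CWK wC cC]].
have [Z [BZK /(ses_split ex CA)/(_ CWK) ZDK]] := ses_pushout ex AWK ABC.
have [V [BDV KVK]] := ses_quotient ex BZK ZDK.
by exists (sum WA WC), V; split=> //; [apply/W_sum|apply: IHn KVK _ _].
Qed.

(** If [B] embeds in [V] with cokernel [K], then [Q = V/A] is an extension of [K] by [C], and A -> V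
    -> Q begins a coresolution. [coresnS] provides [V] even when [n = 0]. *)
Lemma coresn_ker n m A B C : ses A B C -> coresn W n B -> coresn W m C ->
  exists k, coresn W k A.
Proof.
move=> ABC /coresnS [V [K [BVK WV cK]]] cC.
have [Q [AVQ CQK]] := ses_quotient ex ABC BVK.
exists (maxn n m).+1, V, Q; split=> //.
by apply: coresn_ext CQK _ _; [apply: coresn_le cC|apply: coresn_le cK];
  rewrite (leq_maxl, leq_maxr).
Qed.

Lemma coresn_summand n A B : coresn W n (sum A B) -> coresn W n A.
Proof.
elim: n A B => [|n IHn] A B; first by case/W_sum.
move=> [D [F [/(ses_summand ex) [K [K' [ADK _ DKF]]] WD cF]]].
exists D, K; split=> //; apply: (IHn _ K').
(* [D] is in [W], hence of length at most [n], as is [F]; so K (+) K' has length at most [n], one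
   less than the given sum. *)
by apply: coresn_ext DKF _ cF; apply: (@coresn_le 0%N).
Qed.

(** The cover 0 -> B -> V -> M -> 0 splits because E(M, B) = 0, which makes [M] a summand of [V]. *)
Lemma coresn_core n M : coresn W n M -> Y M -> W M.
Proof.
move=> cM /Y_cover [B [V [BVM WV YB]]].
by have /W_split/(_ BVM)[/(_ WV) []] := coresn_perp 0 cM YB.
Qed.

(** Let [V -> K] be the approximation of the cokernel [K] of [N -> Y0]. The pullback [Z] of [Y0] and
    [V] over [K] is an extension of [Y0] by [B], hence in [Y], and contains [N] with cokernel [V]:
    this is the second sequence. For the first, [Z] is covered by some [U] in [W], and [P] is the
    preimage of [N] in [U], whose cokernel in [U] is again [V]. *)
Lemma coresn_approx n N : coresn Y n N ->
  (exists B V k, [/\ ses B V N, Y B & coresn W k V]) /\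
  (exists B V k, [/\ ses N B V, Y B & coresn W k V]).
Proof.
elim: n N => [|n IHn] N /= => [YN|[Y0 [K [NYK YY0 /IHn [[B [V [k [BVK YB cV]]]] _]]]]].
  split; first by have [B [V [BVN WV YB]]] := Y_cover YN; exists B, V, 0%N.
  by exists N, zero, 0%N; split=> //; apply: ses_zero ex _.
have [Z [NZV BZY]] := ses_pullback ex NYK BVK.
have YZ : Y Z by apply: Y_ext BZY _ _.
split; last by exists Z, V, k.
have [B' [U [BUZ WU YB']]] := Y_cover YZ.
have [P [PUV BPN]] := ses_preimage ex NZV BUZ.
by exists B', P, k.+1; split=> //; exists U, V.
Qed.

End WeakContext.

(** * Modules and their opposite as exact structures *)

Section ModuleStructure.
Variable R : pzRingType.
Implicit Types A B C D F K M N : lmodType R.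

Definition ses A B C := exists (f : {linear A -> B}) (g : {linear B -> C}), short_exact f g.

Definition zero_module : lmodType R := void -> R^o.

Lemma zero_module_eq0 (x : zero_module) : x = 0.
Proof. by apply: funext => - []. Qed.

Lemma in_l_linear A B : linear (fun a : A => (a, 0) : A * B).
Proof. by move=> a x y; congr pair; rewrite /= scaler0 addr0. Qed.
Definition in_l A B : {linear A -> (A * B)%type} := mk_linear (@in_l_linear A B).

Lemma in_r_linear A B : linear (fun b : B => (0, b) : A * B).
Proof. by move=> a x y; congr pair; rewrite /= scaler0 addr0. Qed.
Definition in_r A B : {linear B -> (A * B)%type} := mk_linear (@in_r_linear A B).

Lemma ses_zero_r A : ses A A zero_module.
Proof.
exists idfun, \0; split=> // y.
  by split=> // _; exists y.
by exists 0; rewrite [RHS]zero_module_eq0.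
Qed.

Lemma ses_zero_l A : ses zero_module A A.
Proof.
exists \0, idfun; split=> [x y _|y|y].
- by rewrite [x]zero_module_eq0 [y]zero_module_eq0.
- by split=> [/= ->|[x <-]//]; exists 0.
- by exists y.
Qed.

Lemma module_pullback A B C A' B' : ses A B C -> ses A' B' C ->
  exists D, ses A D B' /\ ses A' D B.
Proof.
move=> [f [g fg]] [f' [g' fg']].
pose d : {linear (B * B')%type -> C} := (g \o fst) \- (g' \o snd).
have dP z : d z = 0 <-> g z.1 = g' z.2.
  by rewrite -[d z]/(g z.1 - g' z.2); split=> [/eqP|->]; rewrite ?subrr // subr_eq0 => /eqP.
have [i [i_inj iP iX]] : exists i : {linear kernel d -> (B * B')%type},
    [/\ injective i, forall z, g (i z).1 = g' (i z).2 &
        forall z, g z.1 = g' z.2 -> exists x, i x = z].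
  exists (ker_incl d); split=> [x y|z|z /dP/ker_incl_exact//]; first exact: val_inj.
  by apply/dP/ker_incl_exact; exists z.
have [a aE] : exists a : {linear A -> kernel d}, forall x, i (a x) = (f x, 0).
  apply: (linear_lift (h := in_l B B' \o f) i_inj) => x; apply: iX.
  by rewrite /= (short_exact_comp fg) linear0.
have [a' aE'] : exists a : {linear A' -> kernel d}, forall x, i (a x) = (0, f' x).
  apply: (linear_lift (h := in_r B B' \o f') i_inj) => x; apply: iX.
  by rewrite /= (short_exact_comp fg') linear0.
exists (kernel d); split.
  exists a, (snd \o i); split=> [x y|z|y].
  - by move=> /(congr1 (fst \o i)) /=; rewrite !aE; apply: (short_exact_inj fg).
  - split=> [/= z0|[x <-]]; last by rewrite /= aE.
    have /(short_exact_im fg)[x xE] : g (i z).1 = 0 by rewrite iP z0 linear0.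
    by exists x; apply: i_inj; rewrite aE xE -z0; case: (i z).
  - have [x xE] := short_exact_surj fg (g' y).
    by have [z zE] := iX (x, y) xE; exists z; rewrite /= zE.
exists a', (fst \o i); split=> [x y|z|y].
- by move=> /(congr1 (snd \o i)) /=; rewrite !aE'; apply: (short_exact_inj fg').
- split=> [/= z0|[x <-]]; last by rewrite /= aE'.
  have /(short_exact_im fg')[x xE] : g' (i z).2 = 0 by rewrite -iP z0 linear0.
  by exists x; apply: i_inj; rewrite aE' xE -z0; case: (i z).
- have [x xE] := short_exact_surj fg' (g y).
  by have [z zE] := iX (y, x) (esym xE); exists z; rewrite /= zE.
Qed.

Lemma module_pushout A B C B' C' : ses A B C -> ses A B' C' ->
  exists D, ses B' D C /\ ses B D C'.
Proof.
move=> [f [g fg]] [f' [g' fg']].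
pose d : {linear A -> (B * B')%type} := (in_l B B' \o f) \- (in_r B B' \o f').
have dE x : d x = (f x, - f' x).
  by rewrite -[d x]/(f x - 0, 0 - f' x) subr0 sub0r.
have d_inj : injective d by move=> x y; rewrite !dE => -[/(short_exact_inj fg)].
pose p := coker_proj d.
have dp : short_exact d p by apply: short_exact_coker.
have pP z : p z = 0 <-> exists x, (f x, - f' x) = z.
  by split=> [/(short_exact_im dp)[x <-]|[x <-]]; [exists x|]; rewrite -?dE ?(short_exact_comp dp).
have [u uE] : exists u : {linear coker d -> C}, forall z, u (p z) = g z.1.
  apply: (short_exact_desc dp (h := g \o fst)) => x.
  by rewrite dE /= (short_exact_comp fg).
have [u' uE'] : exists u : {linear coker d -> C'}, forall z, u (p z) = g' z.2.
  apply: (short_exact_desc dp (h := g' \o snd)) => x.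
  by rewrite dE /= linearN (short_exact_comp fg') oppr0.
have p_surj := short_exact_surj dp.
have eqp z z' : (exists x, (f x, - f' x) = z - z') -> p z = p z'.
  by move=> /pP/eqP; rewrite linearB subr_eq0 => /eqP.
exists (coker d); split.
  exists (p \o in_r B B'), u; split=> [|z|y].
  - apply: linear_inj => x /pP[a [fa <-]].
    by rewrite -(linear0 f) in fa; rewrite (short_exact_inj fg fa) linear0 oppr0.
  - split=> [|[x <-]]; last by rewrite /= uE linear0.
    have [[b b'] <-] := p_surj z; rewrite uE => /(short_exact_im fg)[a /= <-].
    exists (b' + f' a); apply: eqp; exists (- a).
    by congr pair; rewrite /= linearN ?sub0r // opprK addrAC subrr add0r.
  - by have [b <-] := short_exact_surj fg y; exists (p (b, 0)); rewrite uE.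
exists (p \o in_l B B'), u'; split=> [|z|y].
- apply: linear_inj => x /pP[a [<- /eqP]]; rewrite oppr_eq0 => /eqP fa.
  by rewrite -(linear0 f') in fa; rewrite (short_exact_inj fg' fa) linear0.
- split=> [|[x <-]]; last by rewrite /= uE' linear0.
  have [[b b'] <-] := p_surj z; rewrite uE' => /(short_exact_im fg')[a /= <-].
  exists (b + f a); apply: eqp; exists a.
  by congr pair; rewrite /= ?sub0r // addrAC subrr add0r.
- by have [b <-] := short_exact_surj fg' y; exists (p (0, b)); rewrite uE'.
Qed.

Lemma module_quotient A B C D F : ses A B C -> ses B D F ->
  exists V, ses A D V /\ ses C V F.
Proof.
move=> [f [g fg]] [u [v uv]].
have uf_inj : injective (u \o f).
  by move=> x y /(short_exact_inj uv)/(short_exact_inj fg).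
pose q := coker_proj (u \o f); have ufq := short_exact_coker uf_inj.
have [c cE] : exists c : {linear C -> coker (u \o f)}, forall x, c (g x) = q (u x).
  by apply: (short_exact_desc fg (h := q \o u)) => x; apply: (short_exact_comp ufq).
have [w wE] : exists w : {linear coker (u \o f) -> F}, forall x, w (q x) = v x.
  by apply: (short_exact_desc ufq) => x; apply: (short_exact_comp uv).
exists (coker (u \o f)); split; first by exists (u \o f), q.
exists c, w; split=> [|z|y].
- apply: linear_inj => x; have [b <-] := short_exact_surj fg x.
  rewrite cE => /(short_exact_im ufq)[a /(short_exact_inj uv) <-].
  exact: short_exact_comp fg _.
- split=> [|[x <-]]; last first.
    by have [b <-] := short_exact_surj fg x; rewrite cE wE (short_exact_comp uv).
  have [d <-] := short_exact_surj ufq z; rewrite wE => /(short_exact_im uv)[b <-].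
  by exists (g b); rewrite cE.
- by have [d <-] := short_exact_surj uv y; exists (q d); rewrite wE.
Qed.

Lemma module_preimage A B C D F : ses C B A -> ses F D B ->
  exists V, ses V D A /\ ses F V C.
Proof.
move=> [f [g fg]] [u [v uv]].
have gv_surj : surjective (g \o v).
  move=> x; have [b <-] := short_exact_surj fg x.
  by have [d <-] := short_exact_surj uv b; exists d.
pose i := ker_incl (g \o v); have igv := short_exact_ker gv_surj.
have [a aE] : exists a : {linear F -> kernel (g \o v)}, forall x, i (a x) = u x.
  by apply: (short_exact_lift igv) => x /=; rewrite (short_exact_comp uv) linear0.
have [w wE] : exists w : {linear kernel (g \o v) -> C}, forall x, f (w x) = v (i x).
  by apply: (short_exact_lift fg (h := v \o i)) => x; apply: (short_exact_comp igv).
exists (kernel (g \o v)); split; first by exists i, (g \o v).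
exists a, w; split=> [|z|y].
- by move=> x y /(congr1 i); rewrite !aE; apply: (short_exact_inj uv).
- split=> [z0|[x <-]]; last first.
    by apply: (short_exact_inj fg); rewrite wE aE (short_exact_comp uv) linear0.
  have /(short_exact_im uv)[x xE] : v (i z) = 0 by rewrite -wE z0 linear0.
  by exists x; apply: (short_exact_inj igv); rewrite aE.
- have [d dE] := short_exact_surj uv (f y).
  have /(short_exact_im igv)[z zE] : (g \o v) d = 0.
    by rewrite /= dE (short_exact_comp fg).
  by exists z; apply: (short_exact_inj fg); rewrite wE [i z]zE dE.
Qed.

Lemma short_exact_retraction A B C (f : {linear A -> B}) (g : {linear B -> C}) :
  short_exact f g -> ext1 C A -> exists r : {linear B -> A}, cancel f r.
Proof. by move=> fg /(_ _ _ _ _ idfun fg). Qed.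

(** The retraction [r] identifies [B] with A (+) C, and under this identification the embedding into
    A (+) D is the identity on [A] and [u] on [C]. *)
Lemma module_split A B C D F : extv 0 C A -> ses A B C -> ses C D F ->
  ses B (A * D)%type F.
Proof.
move=> CA [f [g fg]] [u [v uv]]; have [r rf] := short_exact_retraction fg CA.
have [s sE] : exists s : {linear B -> (A * D)%type}, forall x, s x = (r x, u (g x)).
  exists ((in_l A D \o r) \+ (in_r A D \o (u \o g))) => x.
  by rewrite -[LHS]/(r x + 0, 0 + u (g x)) addr0 add0r.
exists s, (v \o snd).
split=> [|[a d]|y].
- apply: linear_inj => x; rewrite sE => -[r0]; rewrite -(linear0 u).
  move=> /(short_exact_inj uv)/(short_exact_im fg)[a aE].
  by rewrite -aE rf in r0; rewrite -aE r0 linear0.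
- split=> [/(short_exact_im uv)[c cE]|[x]]; last first.
    by rewrite sE => -[_ <-]; apply: (short_exact_comp uv).
  have [b bE] := short_exact_surj fg c.
  exists (b + f (a - r b)); rewrite sE linearD rf addrC subrK.
  by rewrite linearD (short_exact_comp fg) addr0 bE cE.
- by have [d <-] := short_exact_surj uv y; exists (0, d).
Qed.

Lemma module_split_op A B C D F : extv 0 A C -> ses C B A -> ses F D C ->
  ses F (A * D)%type B.
Proof.
move=> AC [f [g fg]] [u [v uv]].
have [s gs] := ext1_lift fg AC idfun.
exists (in_r A D \o u), ((s \o fst) \+ (f \o (v \o snd))); split=> [|[a d]|y].
- by apply: linear_inj => x [/eqP]; rewrite -(linear0 u) => /eqP/(short_exact_inj uv).
- split=> [/= ad0|[x [<- <-]]]; last first.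
    by rewrite /= linear0 (short_exact_comp uv) linear0 addr0.
  have a0 : a = 0.
    by have := congr1 g ad0; rewrite linearD gs (short_exact_comp fg) addr0 linear0.
  move: ad0; rewrite a0 linear0 add0r -(linear0 f) => /(short_exact_inj fg).
  by move=> /(short_exact_im uv)[x <-]; exists x.
- have /(short_exact_im fg)[c cE] : g (y - s (g y)) = 0 by rewrite linearB gs subrr.
  have [d dE] := short_exact_surj uv c.
  by exists (g y, d); rewrite /= dE cE addrC subrK.
Qed.

Lemma module_summand A A' D F : ses (A * A')%type D F ->
  exists K K', [/\ ses A D K, ses A' D K' & ses D (K * K')%type F].
Proof.
move=> [f [g fg]].
have f1_inj : injective (f \o in_l A A') by move=> x y /(short_exact_inj fg)[].
have f2_inj : injective (f \o in_r A A') by move=> x y /(short_exact_inj fg)[].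
have [K [q ex1]] : exists K (q : {linear D -> K}), short_exact (f \o in_l A A') q.
  by exists (coker (f \o in_l A A')), (coker_proj _); apply: short_exact_coker.
have [K' [q' ex2]] : exists K (q : {linear D -> K}), short_exact (f \o in_r A A') q.
  by exists (coker (f \o in_r A A')), (coker_proj _); apply: short_exact_coker.
have [w wE] : exists w : {linear K -> F}, forall x, w (q x) = g x.
  by apply: (short_exact_desc ex1) => x; apply: (short_exact_comp fg).
have [w' wE'] : exists w : {linear K' -> F}, forall x, w (q' x) = g x.
  by apply: (short_exact_desc ex2) => x; apply: (short_exact_comp fg).
exists K, K'; split.
- by exists (f \o in_l A A'), q.
- by exists (f \o in_r A A'), q'.
have [s sE] : exists s : {linear D -> (K * K')%type},
    forall x, s x = (q x, - q' x).
  exists ((in_l _ _ \o q) \- (in_r _ _ \o q')) => x.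
  by rewrite -[LHS]/(q x - 0, 0 - q' x) subr0 sub0r.
exists s, ((w \o fst) \+ (w' \o snd)).
split=> [|[k k']|y].
- apply: linear_inj => x; rewrite sE => -[/(short_exact_im ex1)[a aE]].
  move=> /eqP; rewrite oppr_eq0 => /eqP/(short_exact_im ex2)[a' a'E].
  by move: aE; rewrite -a'E => /(short_exact_inj fg) [_ <-]; rewrite linear0.
- have [d <-] := short_exact_surj ex1 k; have [d' <-] := short_exact_surj ex2 k'.
  split=> [|[x]]; last first.
    by rewrite sE => -[<- <-]; rewrite /= linearN wE wE' subrr.
  rewrite /= wE wE' -linearD => /(short_exact_im fg)[[a a'] aE].
  (* As [d + d' = f (a, a')], this element equals [f (0, a') - d']: it agrees with [d] modulo [A]
     and with [- d'] modulo [A'], and the sign in [s] turns the latter class into that of [d']. *)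
  exists (d - f (a, 0)); rewrite sE; congr pair.
    by rewrite linearB [X in _ - X](short_exact_comp ex1) subr0.
  have -> : d - f (a, 0) = f (0, a') - d'.
    apply/eqP; rewrite subr_eq addrAC eq_sym subr_eq -aE -linearD; apply/eqP.
    by congr (f _); congr pair; rewrite /= ?add0r ?addr0.
  by rewrite linearB [X in X - _](short_exact_comp ex2) sub0r opprK.
- by have [d <-] := short_exact_surj fg y; exists (q d, 0); rewrite /= wE linear0 addr0.
Qed.

Lemma module_summand_op A A' D F : ses F D (A * A')%type ->
  exists K K', [/\ ses K D A, ses K' D A' & ses F (K * K')%type D].
Proof.
move=> [f [g fg]].
have g_surj := short_exact_surj fg.
have g1_surj : surjective (fst \o g).
  by move=> x; have [d dE] := g_surj (x, 0); exists d; rewrite /= dE.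
have g2_surj : surjective (snd \o g).
  by move=> x; have [d dE] := g_surj (0, x); exists d; rewrite /= dE.
have [K [i ex1]] : exists K (i : {linear K -> D}), short_exact i (fst \o g).
  by exists (kernel (fst \o g)), (ker_incl _); apply: short_exact_ker.
have [K' [i' ex2]] : exists K (i : {linear K -> D}), short_exact i (snd \o g).
  by exists (kernel (snd \o g)), (ker_incl _); apply: short_exact_ker.
have [w wE] : exists w : {linear F -> K}, forall x, i (w x) = f x.
  by apply: (short_exact_lift ex1) => x /=; rewrite (short_exact_comp fg).
have [w' wE'] : exists w : {linear F -> K'}, forall x, i' (w x) = f x.
  by apply: (short_exact_lift ex2) => x /=; rewrite (short_exact_comp fg).
exists K, K'; split.
- by exists i, (fst \o g).
- by exists i', (snd \o g).
have [s sE] : exists s : {linear F -> (K * K')%type},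
    forall x, s x = (w x, - w' x).
  exists ((in_l _ _ \o w) \- (in_r _ _ \o w')) => x.
  by rewrite -[LHS]/(w x - 0, 0 - w' x) subr0 sub0r.
exists s, ((i \o fst) \+ (i' \o snd)).
split=> [x y|[k k']|y].
- by rewrite !sE => -[/(congr1 i)]; rewrite !wE => /(short_exact_inj fg).
- split=> [/= kk'|[x]]; last by rewrite sE => -[<- <-]; rewrite /= linearN wE wE' subrr.
  have /(short_exact_im fg)[x xE] : g (i k) = 0.
    apply/eqP; rewrite -[_ == _]/((_ == _) && (_ == _)).
    have k1 := short_exact_comp ex1 k; have k2 := short_exact_comp ex2 k'.
    rewrite [X in X && _](_ : _ = true); last exact/eqP.
    move: kk' => /eqP; rewrite addr_eq0 => /eqP ->; rewrite linearN.
    by rewrite [X in _ && X](_ : _ = true) //; apply/eqP; rewrite /= [X in - X]k2 oppr0.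
  exists x; rewrite sE; congr pair; first by apply: (short_exact_inj ex1); rewrite wE.
  apply: (short_exact_inj ex2); rewrite linearN wE' xE.
  by move: kk' => /eqP; rewrite addr_eq0 => /eqP ->; rewrite opprK.
- have [d dE] := g_surj (0, (g y).2).
  have /(short_exact_im ex1)[k kE] : (fst \o g) d = 0 by rewrite /= dE.
  have /(short_exact_im ex2)[k' kE'] : (snd \o g) (y - d) = 0.
    by rewrite /= linearB dE /= subrr.
  by exists (k, k'); rewrite /= [i k]kE [i' k']kE' addrC subrK.
Qed.

Lemma ses_extv_l n A B C N : ses A B C -> extv n B N -> extv n.+1 C N -> extv n A N.
Proof. by move=> [f [g fg]]; exact: (extv_kernel fg). Qed.

Lemma ses_extv_r n A B C N : ses C B A -> extv n N B -> extv n.+1 N C -> extv n N A.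
Proof. by move=> [f [g fg]]; exact: (extv_coker_r fg). Qed.

Lemma module_structure : exact_structure ses (fun A B => (A * B)%type : lmodType R)
  zero_module (fun n A B => extv n A B).
Proof.
split.
- exact: ses_zero_r.
- exact: module_pullback.
- exact: module_pushout.
- exact: module_quotient.
- exact: module_preimage.
- exact: module_split.
- exact: module_summand.
- exact: ses_extv_l.
Qed.

Lemma module_structure_op : exact_structure (fun A B C => ses C B A)
  (fun A B => (A * B)%type : lmodType R) zero_module (fun n A B => extv n B A).
Proof.
split.
- exact: ses_zero_l.
- by move=> A B C A' B' /module_pushout ABC /ABC.
- by move=> A B C A' B' /module_pullback ABC /ABC.
- exact: module_preimage.
- exact: module_quotient.
- exact: module_split_op.
- exact: module_summand_op.
- exact: ses_extv_r.
Qed.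

End ModuleStructure.

Lemma inj_surj_bij (T U : Type) (f : T -> U) : injective f -> surjective f -> bijective f.
Proof.
by move=> f_inj /choice[g fg]; exists g => // x; apply: f_inj.
Qed.

(** * Summands as retracts; finite coresolutions and resolutions *)

Section Classes.
Variable R : pzRingType.
Implicit Types (A B C K M N : lmodType R) (X W Y : modclass R).

Lemma dsummandE M N : dsummand M N <-> retract M N.
Proof.
split=> [[K [f f_bij]]|[i [r ir]]].
  have f_inj := bij_inj f_bij; case: f_bij => f' f'K fK.
  have [k fk] : exists k : {linear N -> (M * K)%type}, forall x, f (k x) = x.
    by apply: (linear_lift (h := idfun) f_inj) => x; exists (f' x).
  exists (f \o in_l M K), (fst \o k) => x /=.
  by rewrite (f_inj _ _ (fk (f (x, 0)))).
have r_surj : surjective r by move=> x; exists (i x).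
have [K [k kr]] : exists K (k : {linear K -> N}), short_exact k r.
  by exists (kernel r), (ker_incl _); apply: short_exact_ker.
exists K, ((i \o fst) \+ (k \o snd)); apply: inj_surj_bij => [|y].
  apply: linear_inj => -[x z] /= xz0.
  have x0 : x = 0.
    by have := congr1 r xz0; rewrite linearD ir (short_exact_comp kr) addr0 linear0.
  move: xz0; rewrite x0 linear0 add0r -(linear0 k).
  by move=> /(short_exact_inj kr) ->.
have /(short_exact_im kr)[z zE] : r (y - i (r y)) = 0 by rewrite linearB ir subrr.
by exists (r y, z); rewrite /= zE addrC subrK.
Qed.

Lemma retract_refl M : retract M M. Proof. by exists idfun, idfun. Qed.

Lemma retract_trans M N K : retract M N -> retract N K -> retract M K.
Proof.
move=> [i [r ir]] [i' [r' ir']]; exists (i' \o i), (r \o r') => x /=.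
by rewrite ir' ir.
Qed.

Lemma retract_zero M : retract (zero_module R) M.
Proof. by exists \0, \0 => x; rewrite [RHS]zero_module_eq0. Qed.

Lemma retract_l M N : retract M (M * N)%type.
Proof. by exists (in_l M N), fst. Qed.

Lemma retract_r M N : retract N (M * N)%type.
Proof. by exists (in_r M N), snd. Qed.

Lemma retract_prod M M' N N' : retract M M' -> retract N N' ->
  retract (M * N)%type (M' * N')%type.
Proof.
move=> [i [r ir]] [i' [r' ir']].
exists ((in_l _ _ \o (i \o fst)) \+ (in_r _ _ \o (i' \o snd))).
exists ((in_l _ _ \o (r \o fst)) \+ (in_r _ _ \o (r' \o snd))) => -[x y] /=.
by congr pair; rewrite /= !(addr0, add0r) (ir, ir').
Qed.

Lemma split_retract A B C (f : {linear A -> B}) (g : {linear B -> C}) :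
  short_exact f g -> ext1 C A ->
  [/\ retract A B, retract C B & retract B (A * C)%type].
Proof.
move=> fg CA; have [r rf] := short_exact_retraction fg CA.
have [s sE] : exists s : {linear C -> B}, forall x, s (g x) = x - f (r x).
  apply: (short_exact_desc fg (h := idfun \- (f \o r))) => x /=.
  by rewrite rf subrr.
split; first by exists f, r.
  exists s, g => y; have [x <-] := short_exact_surj fg y.
  by rewrite sE linearB (short_exact_comp fg) subr0.
exists ((in_l A C \o r) \+ (in_r A C \o g)), ((f \o fst) \+ (s \o snd)) => x /=.
by rewrite addr0 add0r sE addrC subrK.
Qed.

Definition retract_closed X := forall M N, retract M N -> X N -> X M.

Lemma closed_summandsE X : closed_summands X <-> retract_closed X.
Proof. by split=> XP M N /dsummandE; apply: XP. Qed.

Section Coresolutions.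
Variable X : modclass R.
Hypothesis X_retract : retract_closed X.

Lemma coresolution_shift M (Z : coresolution M) : exists K (Z' : coresolution K),
  ses M (Z 0%N) K /\ forall n, Z' n = Z n.+1.
Proof.
(* The cokernel of [M -> Z 0], realized as a submodule of [Z 1] so that the tail of [Z] coresolves
   it by inclusion. *)
pose K : lmodType R := kernel (cores_d Z 1).
have [p pE] : exists p : {linear Z 0%N -> K},
    forall x, ker_incl (cores_d Z 1) (p x) = cores_d Z 0 x.
  apply: linear_lift => [x y|x]; first exact: val_inj.
  by apply/ker_incl_exact/cores_exactS; exists x.
have i_inj : injective (ker_incl (cores_d Z 1)) by move=> x y; apply: val_inj.
exists K, (@Coresolution R K (fun n => Z n.+1) (fun n => cores_d Z n.+1) (ker_incl (cores_d Z 1))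
  i_inj (@ker_incl_exact _ _ _ _) (fun n => @cores_exactS R M Z n.+1)).
split=> //; exists (cores_aug Z), p; split=> [|y|y]; first exact: cores_aug_inj.
- rewrite -cores_exact0; split=> [py|y0]; first by rewrite -pE py linear0.
  by apply: i_inj; rewrite pE y0 linear0.
- have /cores_exactS[x xE] : cores_d Z 1 (ker_incl (cores_d Z 1) y) = 0.
    by apply/ker_incl_exact; exists y.
  by exists x; apply: i_inj; rewrite pE.
Qed.

(** A coresolution of length 0 only says that [M] is isomorphic to [Z 0]; closure under retracts
    absorbs the isomorphism. *)
Lemma coresn_of_cores M : cores X M -> exists n, coresn (@ses R) X n M.
Proof.
move=> [Z [n [XZ Z0]]]; exists n; elim: n M Z XZ Z0 => [|n IHn] M Z XZ Z0.
  apply: X_retract (XZ 0%N isT).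
  have [k kE] : exists k : {linear Z 0%N -> M}, forall y, cores_aug Z (k y) = y.
    apply: (linear_lift (h := idfun)) => [|y]; first exact: cores_aug_inj.
    by apply/cores_exact0; rewrite [LHS]Z0.
  by exists (cores_aug Z), k => x; apply: (@cores_aug_inj _ _ Z).
have [K [Z' [MZK Z'E]]] := coresolution_shift Z.
exists (Z 0%N), K; split=> //; first exact: XZ.
apply: (IHn K Z') => i i_n; rewrite Z'E; first exact: XZ.
exact: Z0.
Qed.

Lemma cores_of_coresn n M : coresn (@ses R) X n M -> cores X M.
Proof.
elim: n M => [|n IHn] M /= => [XM|[V [K [[f [g fg]] XV /IHn [Z [m [XZ Z0]]]]]]].
  pose Z n : lmodType R := if n is 0 then M else zero_module R.
  have Zex0 : exact_at (idfun : {linear M -> Z 0%N}) (\0 : {linear Z 0%N -> Z 1%N}).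
    by move=> y; split=> // _; exists y.
  have ZexS k : exact_at (\0 : {linear Z k -> Z k.+1}) (\0 : {linear Z k.+1 -> Z k.+2}).
    by move=> y; split=> // _; exists 0; rewrite [RHS]zero_module_eq0.
  exists (@Coresolution R M Z (fun n => \0) idfun (fun x y e => e) Zex0 ZexS), 0%N.
  by split=> [[]|[//|i] _ x] //; apply: zero_module_eq0.
pose Z' n : lmodType R := if n is k.+1 then Z k else V.
pose d n : {linear Z' n -> Z' n.+1} :=
  match n with 0 => cores_aug Z \o g | k.+1 => cores_d Z k end.
have ex0 : exact_at f (d 0%N).
  move=> y; split=> [/= y0|[x <-]]; last by rewrite /= (short_exact_comp fg) linear0.
  by apply: (short_exact_im fg); apply: (@cores_aug_inj _ _ Z); rewrite y0 linear0.
have exS k : exact_at (d k) (d k.+1).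
  case: k => [|k]; last exact: cores_exactS.
  move=> y; rewrite /d cores_exact0; split=> [[x <-]|[x <-]]; last by exists (g x).
  by have [z <-] := short_exact_surj fg x; exists z.
exists (@Coresolution R M Z' d f (short_exact_inj fg) ex0 exS), m.+1.
by split=> [[//|i] im|[//|i] im x]; [apply: XZ|apply: Z0].
Qed.

Lemma resolution_shiftE M (Z : resolution M) : exists K (Z' : resolution K),
  ses K (Z 0%N) M /\ forall n, Z' n = Z n.+1.
Proof.
have [Z' [Z'E _]] := shift_resolution Z; exists (kernel (res_aug Z)), Z'; split=> //.
by exists (ker_incl _), (res_aug Z); apply/short_exact_ker/res_aug_surj.
Qed.

Let ses_op A B C := ses C B A.

Lemma coresn_of_res M : res X M -> exists n, coresn ses_op X n M.
Proof.
move=> [Z [n [XZ Z0]]]; exists n; elim: n M Z XZ Z0 => [|n IHn] M Z XZ Z0.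
  apply: X_retract (XZ 0%N isT).
  have [|x x0|k kE] := @linear_desc _ _ _ _ (res_aug Z) idfun.
  - exact: res_aug_surj.
  - by move/res_exact0: x0 => [y <-]; rewrite [y]Z0 // linear0.
  - exists k, (res_aug Z) => x; have [y <-] := @res_aug_surj _ _ Z x.
    by rewrite kE.
have [K [Z' [MZK Z'E]]] := resolution_shiftE Z.
exists (Z 0%N), K; split=> //; first exact: XZ.
apply: (IHn K Z') => i i_n; rewrite Z'E; first exact: XZ.
exact: Z0.
Qed.

Lemma res_of_coresn n M : coresn ses_op X n M -> res X M.
Proof.
elim: n M => [|n IHn] M /= => [XM|[V [K [[f [g fg]] XV /IHn [Z [m [XZ Z0]]]]]]].
  pose Z n : lmodType R := if n is 0 then M else zero_module R.
  have Zsurj : surjective (idfun : {linear Z 0%N -> M}) by move=> y; exists y.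
  have Zex0 : exact_at (\0 : {linear Z 1%N -> Z 0%N}) (idfun : {linear Z 0%N -> M}).
    by move=> y; split=> [/= ->|[x <-]//]; exists 0.
  have ZexS k : exact_at (\0 : {linear Z k.+2 -> Z k.+1}) (\0 : {linear Z k.+1 -> Z k}).
    by move=> y; split=> // _; exists 0; rewrite [RHS]zero_module_eq0.
  exists (@Resolution R M Z (fun n => \0) idfun Zsurj Zex0 ZexS), 0%N.
  by split=> [[]|[//|i] _ x] //; apply: zero_module_eq0.
pose Z' n : lmodType R := if n is k.+1 then Z k else V.
pose d n : {linear Z' n.+1 -> Z' n} :=
  match n with 0 => f \o res_aug Z | k.+1 => res_d Z k end.
have ex0 : exact_at (d 0%N) g.
  move=> y; split=> [/(short_exact_im fg)[x <-]|[x <-]]; last exact: (short_exact_comp fg).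
  by have [z <-] := @res_aug_surj _ _ Z x; exists z.
have exS k : exact_at (d k.+1) (d k).
  case: k => [|k]; last exact: res_exactS.
  move=> y; rewrite /d -res_exact0 /=; split=> [|->]; last exact: linear0.
  by rewrite -{1}(linear0 f) => /(short_exact_inj fg).
exists (@Resolution R M Z' d g (short_exact_surj fg) ex0 exS), m.+1.
by split=> [[//|i] im|[//|i] im x]; [apply: XZ|apply: Z0].
Qed.

Lemma coresn_iso n M N (f : {linear M -> N}) : bijective f ->
  coresn (@ses R) X n N -> coresn (@ses R) X n M.
Proof.
move=> f_bij; case: n => [|n] /=.
  apply: X_retract; have [|k kE] := linear_lift (h := idfun) (bij_inj f_bij).
    by case: f_bij => f' _ fK x; exists (f' x).
  by exists f, k => x; apply: (bij_inj f_bij).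
move=> [V [K [[u [v uv]] XV cK]]]; exists V, K; split=> //; exists (u \o f), v.
split=> [x y /(short_exact_inj uv)/(bij_inj f_bij)//|y|]; last exact: short_exact_surj uv.
case: f_bij => f' _ fK; split=> [/(short_exact_im uv)[x <-]|[x <-]].
  by exists (f' x); rewrite /= fK.
exact: short_exact_comp uv _.
Qed.

Lemma coresn_iso_op n M N (f : {linear M -> N}) : bijective f ->
  coresn ses_op X n N -> coresn ses_op X n M.
Proof.
move=> f_bij; case: n => [|n] /=; first exact: (@coresn_iso 0%N _ _ _ f_bij).
have f_inj := bij_inj f_bij; case: f_bij => f' f'K fK.
have [k kE] : exists k : {linear N -> M}, forall y, f (k y) = y.
  by apply: (linear_lift (h := idfun) f_inj) => x; exists (f' x).
move=> [V [K [[u [v uv]] XV cK]]]; exists V, K; split=> //; exists u, (k \o v).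
split=> [|y|y]; first exact: short_exact_inj uv.
  split=> [/= /(congr1 f)|[x <-]]; first by rewrite kE linear0 => /(short_exact_im uv).
  by rewrite /= (short_exact_comp uv) linear0.
have [x xE] := short_exact_surj uv (f y); exists x; apply: f_inj.
by rewrite /= kE.
Qed.

End Coresolutions.

(** * From closure properties to weak AB-contexts *)

Section Contexts.
Variables W Y : modclass R.
Hypothesis W_retract : retract_closed W.
Hypothesis W_prod : forall A B, W A -> W B -> W (A * B)%type.
Hypothesis W_inhabited : exists A, W A.
Hypothesis W_sub_Y : subclass W Y.

Let W_zero : W (zero_module R).
Proof. by have [A WA] := W_inhabited; apply: W_retract WA; apply: retract_zero. Qed.

Let W_sum A B : W (A * B)%type <-> W A /\ W B.
Proof.
split=> [WAB|[]]; last exact: W_prod.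
by split; apply: W_retract WAB; [apply: retract_l|apply: retract_r].
Qed.

Let W_split A B C : extv 0 C A -> ses A B C -> (W B <-> W A /\ W C).
Proof.
move=> CA [f [g fg]]; have [AB CB BAC] := split_retract fg CA.
split=> [WB|[WA WC]]; first by split; apply: W_retract WB.
by apply: W_retract BAC _; apply: W_prod.
Qed.

Let W_split_op A B C : extv 0 A C -> ses C B A -> (W B <-> W A /\ W C).
Proof. by move=> EAC CBA; have -> := W_split EAC CBA; split=> -[]. Qed.

Lemma right_context : right_thick Y ->
  (forall n A B, W A -> Y B -> extv n A B) ->
  (forall A, Y A -> exists B V : lmodType R, [/\ ses B V A, W V & Y B]) ->
  right_weak_AB_context W (cores W) Y /\
  forall N, cores Y N ->
    (exists (B V : lmodType R) (f : {linear B -> V}) (g : {linear V -> N}),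
       [/\ short_exact f g, Y B & cores W V]) /\
    (exists (B V : lmodType R) (f : {linear N -> B}) (g : {linear B -> V}),
       [/\ short_exact f g, Y B & cores W V]).
Proof.
move=> Y_thick WY Y_cover; have [Y_ext Y_sum _] := Y_thick.
have Y_retract : retract_closed Y by apply/closed_summandsE.
have Y_ses A B C : ses A B C -> Y A -> Y C -> Y B by move=> [f [g fg]]; apply: Y_ext fg.
have ex := module_structure R.
have cP M : cores W M <-> exists n, coresn (@ses R) W n M.
  split; first exact: coresn_of_cores.
  by move=> [n]; apply: cores_of_coresn.
split; [split=> //; [split; first split|..]|].
- move=> A B C f g fg /cP[n cA] /cP[m cC]; apply/cP; exists (maxn n m).
  apply: (coresn_ext ex W_sum W_split W_sub_Y WY (A := A) (C := C)).
  + by exists f, g.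
  + exact: (coresn_le ex W_zero (leq_maxl n m) cA).
  + exact: (coresn_le ex W_zero (leq_maxr n m) cC).
- move=> M N [K [f f_bij]] /cP[n cN]; apply/cP; exists n.
  apply: (coresn_summand ex W_zero W_sum W_split W_sub_Y WY (B := K)).
  exact: coresn_iso f_bij cN.
- move=> A B C f g fg /cP[n cB] /cP[m cC]; apply/cP.
  by apply: (coresn_ker ex W_zero W_sum W_split W_sub_Y WY _ cB cC); exists f, g.
- by move=> M [Z [n [WZ Z0]]]; exists Z, n; split=> // i /WZ/W_sub_Y.
- move=> M; split=> [WM|[/cP[n cM] YM]].
    by split; [apply/cP; exists 0%N|apply: W_sub_Y].
  exact: (coresn_core ex W_split WY Y_cover cM YM).
- by move=> [//|i] M N _ WM YN; apply/Ext_vanishesE/WY.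
- move=> A YA; have [B [V [[f [g fg]] WV YB]]] := Y_cover A YA.
  by exists B, V, f, g.
move=> N /(coresn_of_cores Y_retract)[n cN].
have [] := coresn_approx ex W_zero Y_ses Y_cover cN.
move=> [B [V [k [[f [g fg]] YB cV]]]] [B' [V' [k' [[f' [g' fg']] YB' cV']]]].
split; [exists B, V, f, g|exists B', V', f', g']; split=> //; apply/cP.
  by exists k.
by exists k'.
Qed.

Lemma left_context : left_thick Y ->
  (forall n A B, Y A -> W B -> extv n A B) ->
  (forall A, Y A -> exists B V : lmodType R, [/\ ses A V B, W V & Y B]) ->
  left_weak_AB_context Y (res W) W /\
  forall N, res Y N ->
    (exists (B V : lmodType R) (f : {linear B -> V}) (g : {linear V -> N}),
       [/\ short_exact f g, Y V & res W B]) /\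
    (exists (B V : lmodType R) (f : {linear N -> B}) (g : {linear B -> V}),
       [/\ short_exact f g, Y V & res W B]).
Proof.
move=> Y_thick YW Y_cover; have [Y_ext Y_sum _] := Y_thick.
have Y_retract : retract_closed Y by apply/closed_summandsE.
have Y_ses A B C : ses C B A -> Y A -> Y C -> Y B.
  by move=> [f [g fg]] YA YC; apply: Y_ext fg YC YA.
have WY n A B : W A -> Y B -> extv n B A by move=> WA YB; apply: YW.
have Y_cover' A : Y A -> exists B V : lmodType R, [/\ ses A V B, W V & Y B] by apply: Y_cover.
have ex := module_structure_op R.
have cP M : res W M <-> exists n, coresn (fun A B C => ses C B A) W n M.
  split; first exact: coresn_of_res.
  by move=> [n]; apply: res_of_coresn.
split; [split=> //; [split; first split|..]|].
- move=> A B C f g fg /cP[n cA] /cP[m cC]; apply/cP; exists (maxn n m).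
  apply: (coresn_ext ex W_sum W_split_op W_sub_Y WY (A := C) (C := A)).
  + by exists f, g.
  + exact: (coresn_le ex W_zero (leq_maxr n m) cC).
  + exact: (coresn_le ex W_zero (leq_maxl n m) cA).
- move=> M N [K [f f_bij]] /cP[n cN]; apply/cP; exists n.
  apply: (coresn_summand ex W_zero W_sum W_split_op W_sub_Y WY (B := K)).
  exact: coresn_iso_op f_bij cN.
- move=> A B C f g fg /cP[n cA] /cP[m cB]; apply/cP.
  by apply: (coresn_ker ex W_zero W_sum W_split_op W_sub_Y WY _ cB cA); exists f, g.
- by move=> M [Z [n [WZ Z0]]]; exists Z, n; split=> // i /WZ/W_sub_Y.
- move=> M; split=> [WM|[YM /cP[n cM]]].
    by split; [apply: W_sub_Y|apply/cP; exists 0%N].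
  exact: (coresn_core ex W_split_op WY Y_cover' cM YM).
- by move=> [//|i] M N _ YM WN; apply/Ext_vanishesE/YW.
- move=> A YA; have [B [V [[f [g fg]] WV YB]]] := Y_cover A YA.
  by exists V, B, f, g.
move=> N /(coresn_of_res Y_retract)[n cN].
have [] := coresn_approx ex W_zero Y_ses Y_cover' cN.
move=> [B [V [k [[f [g fg]] YB cV]]]] [B' [V' [k' [[f' [g' fg']] YB' cV']]]].
(* Passing to the opposite exchanges the two approximations. *)
split; [exists V', B', f', g'|exists V, B, f, g]; split=> //; apply/cP.
  by exists k'.
by exists k.
Qed.

End Contexts.

End Classes.

(** * The Bass class *)

Section Bass.
Variables (R : pzRingType) (C : lmodType R).
Implicit Types (A B D L M N : lmodType R).

Local Notation H N := ({linear C -> N} : lmodType (rend C)).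
Local Notation T N := (tens (rmod C) (H N)).

Definition post_fun N N' (f : {linear N -> N'}) (h : H N) : H N' :=
  f \o (h : {linear C -> N}).
Fact post_linear N N' (f : {linear N -> N'}) : linear (post_fun f).
Proof. by move=> s h k; apply: linear_ext => c /=; rewrite linearD. Qed.
Definition post N N' (f : {linear N -> N'}) : {linear H N -> H N'} :=
  mk_linear (post_linear f).

Lemma postE N N' (f : {linear N -> N'}) (h : {linear C -> N}) c :
  (post f h : {linear C -> N'}) c = f (h c).
Proof. by []. Qed.

Fact tens_eval_zmod N : zmod_morphism (@tens_eval R C N).
Proof. by apply: tens_lift_zmod; split=> // h x y; apply: linearD. Qed.
Definition ev N : {additive T N -> N} := mk_additive (tens_eval_zmod (N := N)).

Lemma evE N c (h : {linear C -> N}) : ev N (tensor (c : rmod C) (h : H N)) = h c.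
Proof. exact: tens_eval_tensor. Qed.

Lemma ev_post N N' (f : {linear N -> N'}) x :
  ev N' (tens_map2 (rmod C) (post f) x) = f (ev N x).
Proof.
move: x; apply: (@tens_additive_ext _ _ _ _ (ev N' \o tens_map2 _ (post f)) (f \o ev N)).
move=> c h; rewrite -[LHS]/(ev N' (tens_map2 _ (post f) (tensor c h))) tens_map2E.
by rewrite -[RHS]/(f (ev N (tensor c h))) !evE.
Qed.

Lemma Bass_classE N : Bass_class C N <->
  [/\ forall n, extv n C N, forall n, extv n (rmod C) (charg (H N)),
      injective (ev N) & surjective (ev N)].
Proof.
split=> [[CN /Tor_vanishes_ge1 TN N_bij]|[CN TN ev_inj ev_surj]].
  split; [exact/Ext_vanishes_ge1|exact: TN|exact: bij_inj|].
  by case: N_bij => g _ gK y; exists (g y); apply: gK.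
split; [exact/Ext_vanishes_ge1|exact/Tor_vanishes_ge1|exact: inj_surj_bij].
Qed.

Section Exact.
Variables (A B D : lmodType R) (f : {linear A -> B}) (g : {linear B -> D}).
Hypothesis fg : short_exact f g.

(** Lifting is assumed rather than deduced from Ext^1(C, A) = 0, because in [Bass_kernel] that
    vanishing is part of the conclusion. *)
Lemma post_exact : (forall h : {linear C -> D}, exists k : {linear C -> B},
  forall x, g (k x) = h x) -> short_exact (post f) (post g).
Proof.
move=> g_lift; split=> [h h'|h|h].
- move=> hh'; apply: linear_ext => c; apply: (short_exact_inj fg).
  by rewrite -postE hh'.
- split=> [gh|[k <-]]; last first.
    by apply: linear_ext => c; rewrite !postE (short_exact_comp fg).
  have [|k kE] := short_exact_lift fg (h := h); first by move=> c; rewrite -postE gh.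
  by exists k; apply: linear_ext.
- by have [k kE] := g_lift h; exists k; apply: linear_ext.
Qed.

Lemma Bass_extension : Bass_class C A -> Bass_class C D -> Bass_class C B.
Proof.
move=> /Bass_classE[CA TA evA_inj evA_surj] /Bass_classE[CD TD evD_inj evD_surj].
have pfg := post_exact (ext1_lift fg (CA 0%N)).
have T_exact := tens_map2_exact (M := rmod C) pfg.
have T_surj := tens_map2_surj (M := rmod C) (short_exact_surj pfg).
apply/Bass_classE; split=> [n|n||y].
- exact: extv_ext_r fg _ _ (CA n) (CD n).
- exact: extv_ext_r (charg_exact pfg) _ _ (TD n) (TA n).
- move=> x y /eqP; rewrite -subr_eq0 -raddfB => /eqP xy; apply/eqP.
  rewrite -subr_eq0; apply/eqP; move: (x - y) xy => {x y} x evx.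
  have /T_exact[z zE] : tens_map2 (rmod C) (post g) x = 0.
    by apply: evD_inj; rewrite ev_post evx !raddf0.
  move: evx; rewrite -zE ev_post -(linear0 f) => /(short_exact_inj fg).
  by rewrite -(raddf0 (ev A)) => /evA_inj ->; rewrite raddf0.
- have [u uE] := evD_surj (g y); have [x xE] := T_surj u.
  have /(short_exact_im fg)[a aE] : g (y - ev B x) = 0.
    by rewrite linearB -ev_post xE uE subrr.
  have [z zE] := evA_surj a; exists (x + tens_map2 (rmod C) (post f) z).
  by rewrite raddfD ev_post zE aE addrC subrK.
Qed.

Lemma Bass_coker : Bass_class C A -> Bass_class C B -> Bass_class C D.
Proof.
move=> /Bass_classE[CA TA evA_inj evA_surj] /Bass_classE[CB TB evB_inj evB_surj].
have pfg := post_exact (ext1_lift fg (CA 0%N)).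
have T_exact := tens_map2_exact (M := rmod C) pfg.
have T_surj := tens_map2_surj (M := rmod C) (short_exact_surj pfg).
(* Through the evaluations this map becomes [f] itself. Its injectivity yields Tor_1(C, Hom(C, D)) =
   0. *)
have T_inj : injective (tens_map2 (rmod C) (post f)).
  move=> x y /(congr1 (ev B)); rewrite !ev_post.
  by move=> /(short_exact_inj fg)/evA_inj.
apply/Bass_classE; split=> [n|[|n]||y].
- exact: extv_coker_r fg _ _ (CB n) (CA n.+1).
- exact: ext1_ker_r (charg_exact pfg) _ (tens_map2_ext T_inj) (TB 0%N).
- exact: extvS_ker_r (charg_exact pfg) _ _ (TA n) (TB n.+1).
- move=> u v; have [x <-] := T_surj u; have [y <-] := T_surj v.
  rewrite !ev_post => /eqP; rewrite -subr_eq0 -linearB -raddfB => /eqP.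
  move=> /(short_exact_im fg)[a aE]; have [z zE] := evA_surj a.
  apply/eqP; rewrite -subr_eq0 -raddfB; apply/eqP/T_exact; exists z.
  by apply: evB_inj; rewrite ev_post zE.
- have [b <-] := short_exact_surj fg y; have [x <-] := evB_surj b.
  by exists (tens_map2 (rmod C) (post g) x); rewrite ev_post.
Qed.

(** Exactness under Hom(C, -) gives Ext^1(C, A) = 0 from Ext^1(C, B) = 0, and Tor_1(C, Hom(C, D)) =
    0 keeps the tensored sequence exact on the left, so the evaluation at [A] can be compared with
    those at [B] and [D]. *)
Lemma Bass_kernel : (forall h : {linear C -> D}, exists k : {linear C -> B},
  forall x, g (k x) = h x) -> Bass_class C B -> Bass_class C D -> Bass_class C A.
Proof.
move=> g_lift /Bass_classE[CB TB evB_inj evB_surj] /Bass_classE[CD TD evD_inj evD_surj].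
have pfg := post_exact g_lift.
have T_exact := tens_map2_exact (M := rmod C) pfg.
have T_inj : injective (tens_map2 (rmod C) (post f)).
  exact/tens_map2_inj/(ext1_lift (charg_exact pfg))/(TD 0%N).
apply/Bass_classE; split=> [[|n]|n|x y|y].
- exact: ext1_ker_r fg _ g_lift (CB 0%N).
- exact: extvS_ker_r fg _ _ (CD n) (CB n.+1).
- exact: extv_coker_r (charg_exact pfg) _ _ (TB n) (TD n.+1).
- by move=> /(congr1 f); rewrite -!ev_post => /evB_inj/T_inj.
- have [x xE] := evB_surj (f y).
  have /T_exact[z zE] : tens_map2 (rmod C) (post g) x = 0.
    by apply: evD_inj; rewrite ev_post xE (short_exact_comp fg) raddf0.
  by exists z; apply: (short_exact_inj fg); rewrite -ev_post zE.
Qed.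

End Exact.

Lemma Bass_retract : retract_closed (Bass_class C).
Proof.
move=> M N [i [r ir]] /Bass_classE[CN TN ev_inj ev_surj].
have MN : retract M N by exists i, r.
have HMN : retract (H M) (H N).
  by exists (post i), (post r) => h; apply: linear_ext => c; rewrite !postE ir.
apply/Bass_classE; split=> [n|n|x y|y].
- exact: extv_retract_r MN (CN n).
- exact: extv_retract_r (retract_charg HMN) (TN n).
- move=> /(congr1 i); rewrite -!ev_post => /ev_inj.
  move=> /(congr1 (tens_map2 (rmod C) (post r))).
  have ri : tens_map2 (rmod C) (post r) \o tens_map2 (rmod C) (post i) =1 idfun.
    apply: (@tens_additive_ext _ _ _ _ (tens_map2 (rmod C) (post r) \o
      tens_map2 (rmod C) (post i)) idfun) => c h.
    rewrite -[LHS]/(tens_map2 _ (post r) (tens_map2 _ (post i) (tensor c h))).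
    rewrite !tens_map2E; congr tensor.
    by apply: linear_ext => d; rewrite !postE ir.
  by have := ri x; have := ri y; rewrite /= => -> ->.
- have [x xE] := ev_surj (i y); exists (tens_map2 (rmod C) (post r) x).
  by rewrite ev_post xE ir.
Qed.

Lemma Bass_thick : right_thick (Bass_class C).
Proof.
split; first by move=> A B D f g fg; apply: Bass_extension fg.
  exact/closed_summandsE/Bass_retract.
by move=> A B D f g fg; apply: Bass_coker fg.
Qed.

(* As a module over the converse of S, the character module of S is coinduced. *)
Lemma charg_end_injective : injective_module (charg (H C) : lmodType (rend C)^c).
Proof.
apply: retract_injective (@coind_injective (rend C)^c).
have a_lin : linear (id : charg (H C) -> coind (rend C)^c).
  by move=> a x y; apply: additive_ext.
have b_lin : linear (id : coind (rend C)^c -> charg (H C)).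
  by move=> a x y; apply: additive_ext.
by exists (mk_linear a_lin), (mk_linear b_lin) => phi.
Qed.

(** * Direct sums of copies of C lie in the Bass class *)

Section SelfSmall.
Hypotheses (C_small : self_small C) (C_orth : sigma_self_orthogonal C).

Section Index.
Variable I : Type.

Local Notation CI := (dsum I C).

Lemma dsum_hom_in i (s : {linear C -> C}) :
  dsum_hom (dsum_in i s : dsum I {linear C -> C}) = dsum_inl C i \o s.
Proof.
apply: linear_ext => c; apply/val_inj/funext => j /=.
by case: asboolP.
Qed.

Lemma dsum_homD (s t : dsum I {linear C -> C}) : dsum_hom (s + t) = dsum_hom s + dsum_hom t.
Proof. by apply: linear_ext => c; apply/val_inj. Qed.

(** Self-smallness as an induction principle: a map from C to C^(I) is a finite sum of endomorphisms
    followed by inclusions. *)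
Lemma hom_dsum_ind (P : {linear C -> CI} -> Prop) : P 0 ->
  (forall h k, P h -> P k -> P (h + k)) ->
  (forall i (s : {linear C -> C}), P (dsum_inl C i \o s)) -> forall h, P h.
Proof.
move=> P0 PD Pin h; have [g gK hK] := C_small I; rewrite -(hK h).
elim/dsum_ind: (g h) => [|s t Ps Pt|i s].
- by rewrite (_ : dsum_hom 0 = 0) //; apply: linear_ext => c; apply/val_inj.
- by rewrite dsum_homD; apply: PD.
- by rewrite dsum_hom_in.
Qed.

(** The universal property of S^(I), transported to Hom(C, C^(I)). *)
Lemma hom_dsum_additive (A : zmodType) (u : I -> {additive {linear C -> C} -> A}) :
  exists k : {additive {linear C -> CI} -> A},
    forall i (s : {linear C -> C}), k (dsum_inl C i \o s) = u i s.
Proof.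
have [g gK hK] := C_small I.
have gB : zmod_morphism g.
  move=> h k; apply: (can_inj gK); rewrite hK.
  have := dsum_homD (g h - g k) (g k); rewrite subrK !hK => {1}->.
  by rewrite addrK.
exists (dsum_elim u \o mk_additive gB) => i s /=.
by rewrite -dsum_hom_in gK; apply: dsum_elim_in.
Qed.

(** The left inverse [l] sends [c] in the summand [i] to [c (x) in_i]. *)
Lemma ev_dsum_inj : injective (ev CI).
Proof.
have tB i : zmod_morphism (fun c : C => tensor (c : rmod C) (dsum_inl C i : H CI)).
  move=> x y; apply/eqP; rewrite eq_sym subr_eq; apply/eqP.
  by rewrite -[LHS](congr1 (fun z : C => tensor (z : rmod C) (dsum_inl C i : H CI)) (subrK y x));
    apply: tensorDl.
pose l := dsum_elim (fun i => mk_additive (tB i)).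
suff lK : cancel (ev CI) l by apply: can_inj lK.
move=> x; apply: (@tens_additive_ext _ _ _ _ (l \o ev CI) idfun) => c h.
rewrite -[LHS]/(l (ev CI (tensor c h))) evE -[RHS]/(tensor c h).
elim/hom_dsum_ind: h => [|h k hE kE|i s].
- rewrite [X in l X](_ : _ = 0) // raddf0; apply/esym/eqP.
  by rewrite -(addrK (tensor c (0 : H CI)) (tensor c (0 : H CI))) -tensorDr addr0 subrr.
- by rewrite [RHS]tensorDr -hE -kE -raddfD.
- rewrite [LHS]dsum_elim_in /=.
  (* Balance over S: [s(c) (x) in_i = c (x) (in_i \o s)]. *)
  by rewrite -[X in tensor X _ = _]/((s : (rend C)^c) *: (c : rmod C)) tensorZ.
Qed.

Lemma ev_dsum_surj : surjective (ev CI).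
Proof.
elim/dsum_ind => [|x y [u <-] [v <-]|i c].
- by exists 0; rewrite raddf0.
- by exists (u + v); rewrite raddfD.
- by exists (tensor (c : rmod C) (dsum_inl C i : H CI)); rewrite evE.
Qed.

(** Flatness of S^(I) in character form: (S^(I))^+ is a power of the injective module S^+. It gives
    the vanishing of Tor over S in [Bass_dsum]. *)
Lemma charg_hom_dsum_injective : injective_module (charg (H CI) : lmodType (rend C)^c).
Proof.
suff : retract (charg (H CI) : lmodType (rend C)^c) ((I -> charg (H C)) : lmodType (rend C)^c).
  move/retract_injective; apply; apply: prod_injective.
  exact: charg_end_injective.
have a_lin : linear (fun (phi : charg (H CI)) i => charg_map (post (dsum_inl C i)) phi).
  by move=> s x y; apply: funext => i; rewrite linearP.
have /choice[b bE] (psi : I -> charg (H C)) := hom_dsum_additive (fun i => ch (psi i)).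
have b_lin : linear (b : (I -> charg (H C)) -> charg (H CI)).
  move=> a x y; apply: additive_ext; elim/hom_dsum_ind => [|h k hE kE|i s].
  - by rewrite !raddf0.
  - by rewrite !raddfD hE kE.
  - rewrite bE /=; congr (_ + _); last by rewrite bE.
    transitivity (b x (dsum_inl C i \o hom_act (a : rend C) s)); first by rewrite bE.
    by congr (ch (b x) _); apply: linear_ext.
exists (mk_linear a_lin), (mk_linear b_lin) => phi; apply: additive_ext.
elim/hom_dsum_ind => [|h k hE kE|i s].
- by rewrite !raddf0.
- by rewrite !raddfD hE kE.
- by rewrite [LHS]bE.
Qed.

Lemma Bass_dsum : Bass_class C CI.
Proof.
apply/Bass_classE; split=> [n|n||].
- exact/Ext_vanishesE/C_orth.
- exact/injective_extv/charg_hom_dsum_injective.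
- exact: ev_dsum_inj.
- exact: ev_dsum_surj.
Qed.

End Index.

Lemma Add_classE M : Add_class C M <-> exists I : Type, retract M (dsum I C).
Proof. by split=> -[I MI]; exists I; apply/dsummandE. Qed.

Lemma Add_retract : retract_closed (Add_class C).
Proof.
move=> M N MN /Add_classE[I NI]; apply/Add_classE; exists I.
exact: retract_trans MN NI.
Qed.

Lemma retract_dsum_prod (I J : Type) :
  retract (dsum I C * dsum J C)%type (dsum (I + J)%type C).
Proof.
have [a aE] := dsum_linear (fun i : I => dsum_inl C (inl i : I + J)).
have [b bE] := dsum_linear (fun j : J => dsum_inl C (inr j : I + J)).
pose u k : {linear C -> (dsum I C * dsum J C)%type} := match k with
  | inl i => in_l _ _ \o dsum_inl C i
  | inr j => in_r _ _ \o dsum_inl C j end.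
have [r rE] := dsum_linear u.
have ra x : r (a x) = (x, 0).
  apply: (dsum_additive_ext (f := r \o a) (g := in_l _ _)) => i c /=.
  by rewrite aE [LHS]rE.
have rb y : r (b y) = (0, y).
  apply: (dsum_additive_ext (f := r \o b) (g := in_r _ _)) => i c /=.
  by rewrite bE [LHS]rE.
exists ((a \o fst) \+ (b \o snd)), r => -[x y] /=.
by rewrite linearD ra rb; congr pair; rewrite /= ?addr0 ?add0r.
Qed.

Lemma Add_prod A B : Add_class C A -> Add_class C B -> Add_class C (A * B)%type.
Proof.
move=> /Add_classE[I AI] /Add_classE[J BJ]; apply/Add_classE; exists (I + J)%type.
exact: retract_trans (retract_prod AI BJ) (retract_dsum_prod I J).
Qed.

Lemma Add_dsum I : Add_class C (dsum I C).
Proof. by apply/Add_classE; exists I; apply: retract_refl. Qed.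

Lemma Add_Bass : subclass (Add_class C) (Bass_class C).
Proof. by move=> M /Add_classE[I MI]; apply: Bass_retract MI (Bass_dsum I). Qed.

Lemma Add_perp_Bass n A B : Add_class C A -> Bass_class C B -> extv n A B.
Proof.
move=> /Add_classE[I AI] /Bass_classE[CB _ _ _].
by apply: extv_retract_l AI _; apply: extv_dsum.
Qed.

(** The evaluation [p] from C^(Hom(C, A)) is onto because [ev A] is. Each [h : C -> A] lifts to the
    inclusion of the summand of index [h], so [Bass_kernel] applies. *)
Lemma Bass_cover A : Bass_class C A ->
  exists B V, [/\ ses B V A, Add_class C V & Bass_class C B].
Proof.
move=> BA; have /Bass_classE[_ _ _ ev_surj] := BA.
have [p pE] := dsum_linear (fun h : {linear C -> A} => h).
have p_surj : surjective p.
  move=> y; have [x <-] := ev_surj y; elim/tens_ind: x => [|x x' [u uE] [v vE]|c h].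
  - by exists 0; rewrite !raddf0.
  - by exists (u - v); rewrite linearB raddfB uE vE.
  - by exists (dsum_in h c); rewrite pE evE.
have kp := short_exact_ker p_surj.
exists (kernel p), (dsum {linear C -> A} C); split; first by exists (ker_incl p), p.
  exact: Add_dsum.
apply: Bass_kernel kp _ (Bass_dsum _) BA => h.
by exists (dsum_inl C h) => c; apply: pE.
Qed.

End SelfSmall.
End Bass.

(** * The Auslander class *)

Section Auslander.
Variables (R : pzRingType) (C : lmodType R).
Implicit Types (A B D M N : lmodType R^c).

Local Notation U := (charg C : lmodType R^c).
Local Notation T M := (tens M C : lmodType (rend C)^c).

Lemma scale_tensor M (s : (rend C)^c) (m : M) (c : C) :
  s *: (tensor m c : T M) = tensor m ((s : {linear C -> C}) c).
Proof. exact: tens_act_tensor. Qed.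

Fact tensC_linear M N (f : {linear M -> N}) : linear (tens_map1 f C : T M -> T N).
Proof.
move=> s x y; rewrite raddfD; congr (_ + _).
have sB L : zmod_morphism (fun z : T L => s *: z) by move=> u v; rewrite scalerBr.
move: x; apply: (@tens_additive_ext _ _ _ _ (tens_map1 f C \o mk_additive (sB M))
  (mk_additive (sB N) \o tens_map1 f C)) => m c.
rewrite -[LHS]/(tens_map1 f C (s *: (tensor m c : T M))) scale_tensor tens_map1E.
by rewrite -[RHS]/(s *: (tens_map1 f C (tensor m c) : T N)) tens_map1E scale_tensor.
Qed.
Definition tensC M N (f : {linear M -> N}) : {linear T M -> T N} :=
  mk_linear (tensC_linear f).

Lemma coeval_nat M N (f : {linear M -> N}) m c :
  coeval C (f m) c = tensC f (coeval C m c).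
Proof. by rewrite [RHS]tens_map1E. Qed.

Lemma coevalB M : zmod_morphism (@coeval R C M).
Proof.
move=> m m'; apply: linear_ext => c; apply/eqP.
by rewrite eq_sym -[_ c]/(tensor m (c : C) - tensor m' (c : C)) subr_eq -tensorDl subrK.
Qed.
Definition coe M : {additive M -> {linear rmod C -> T M}} := mk_additive (@coevalB M).

Lemma Auslander_classE M : Auslander_class C M <->
  [/\ forall n, extv n M U, forall n, extv n (rmod C) (T M),
      forall m, coe M m = 0 -> m = 0 & surjective (coe M)].
Proof.
split=> [[/Tor_vanishes_ge1 MU /Ext_vanishes_ge1 CM M_bij]|[MU CM M0 M_surj]].
  split=> // [m m0|]; last by case: M_bij => k _ kK y; exists (k y); apply: kK.
  by apply: (bij_inj M_bij); rewrite [LHS]m0 -[LHS](raddf0 (coe M)).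
split; [exact/Tor_vanishes_ge1|exact/Ext_vanishes_ge1|apply: inj_surj_bij => //].
move=> x y xy; apply/eqP; rewrite -subr_eq0; apply/eqP/M0.
by rewrite raddfB; apply/eqP; rewrite subr_eq0; apply/eqP.
Qed.

Section Exact.
Variables (A B D : lmodType R^c) (f : {linear A -> B}) (g : {linear B -> D}).
Hypothesis fg : short_exact f g.

(** The hypothesis is the character form of the injectivity of A (x) C -> B (x) C. It follows from
    Tor_1(D, C) = 0, but in [Auslander_coker] that vanishing is to be proved. *)
Lemma tensC_exact : (forall h : {linear A -> U}, exists k : {linear B -> U},
  forall x, k (f x) = h x) -> short_exact (tensC f) (tensC g).
Proof.
move=> f_ext; split.
- exact: tens_map1_inj f_ext.
- exact: tens_map1_exact fg.
- exact: tens_map1_surj (short_exact_surj fg).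
Qed.

Lemma Auslander_extension : Auslander_class C A -> Auslander_class C D -> Auslander_class C B.
Proof.
move=> /Auslander_classE[AU CA A0 A_surj] /Auslander_classE[DU CD D0 D_surj].
have tfg : short_exact (tensC f) (tensC g).
  by apply: tensC_exact => h; apply: DU 0%N _ _ _ _ h fg.
apply/Auslander_classE; split=> [n|n|b b0|phi].
- exact: extv_extension fg _ _ (AU n) (DU n).
- exact: extv_ext_r tfg _ _ (CA n) (CD n).
- have /D0/(short_exact_im fg)[a ab] : coe D (g b) = 0.
    by apply: linear_ext => c; rewrite [LHS]coeval_nat -[coeval _ _]/(coe B b) b0 linear0.
  suff /A0 a0 : coe A a = 0 by rewrite -ab a0 linear0.
  apply: linear_ext => c; apply: (short_exact_inj tfg); rewrite -[LHS]coeval_nat ab.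
  by rewrite -[coeval _ _]/(coe B b) b0 linear0.
- have [d dE] := D_surj (tensC g \o phi).
  have [b bE] := short_exact_surj fg d.
  have [|k kE] := short_exact_lift tfg (h := phi - coe B b).
    move=> c; rewrite -[X in tensC g X]/(phi c - coeval C b c) linearB -coeval_nat bE.
    by rewrite -[coeval _ _]/(coe D d) dE subrr.
  have [a aE] := A_surj k; exists (b + f a); apply: linear_ext => c.
  rewrite raddfD -[LHS]/(coeval C b c + coeval C (f a) c) coeval_nat.
  by rewrite -[coeval C a]/(coe A a) aE kE -[X in _ + X]/(phi c - coeval C b c) addrC subrK.
Qed.

Lemma Auslander_kernel : Auslander_class C B -> Auslander_class C D -> Auslander_class C A.
Proof.
move=> /Auslander_classE[BU CB B0 B_surj] /Auslander_classE[DU CD D0 D_surj].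
have tfg : short_exact (tensC f) (tensC g).
  by apply: tensC_exact => h; apply: DU 0%N _ _ _ _ h fg.
apply/Auslander_classE; split=> [n|[|n]|a a0|phi].
- exact: extv_kernel fg _ _ (BU n) (DU n.+1).
(* Every S-linear map from C to D (x) C is the coevaluation of some [d]; the coevaluation of a
   preimage of [d] in [B] lifts it. *)
- apply: ext1_ker_r tfg _ _ (CB 0%N) => h; have [d dE] := D_surj h.
  have [b bE] := short_exact_surj fg d; exists (coeval C b) => c.
  by rewrite -coeval_nat bE -[coeval C d]/(coe D d) dE.
- exact: extvS_ker_r tfg _ _ (CD n) (CB n.+1).
- apply: (short_exact_inj fg); rewrite linear0; apply: B0; apply: linear_ext => c.
  by rewrite [LHS]coeval_nat -[coeval C a]/(coe A a) a0 linear0.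
- have [b bE] := B_surj (tensC f \o phi).
  have /D0/(short_exact_im fg)[a aE] : coe D (g b) = 0.
    apply: linear_ext => c; rewrite [LHS]coeval_nat -[coeval C b]/(coe B b) bE.
    exact: short_exact_comp tfg _.
  exists a; apply: linear_ext => c; apply: (short_exact_inj tfg).
  by rewrite -[LHS]coeval_nat aE -[coeval C b]/(coe B b) bE.
Qed.

(** Counterpart of [Bass_kernel]: the extension property gives Tor_1(D, C) = 0 and keeps the
    tensored sequence exact, and Ext^1_S(C, A (x) C) = 0 lifts maps from C to D (x) C. *)
Lemma Auslander_coker : (forall h : {linear A -> U}, exists k : {linear B -> U},
  forall x, k (f x) = h x) ->
  Auslander_class C A -> Auslander_class C B -> Auslander_class C D.
Proof.
move=> f_ext /Auslander_classE[AU CA A0 A_surj] /Auslander_classE[BU CB B0 B_surj].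
have tfg := tensC_exact f_ext.
apply/Auslander_classE; split=> [[|n]|n|d|phi].
- exact: ext1_coker fg _ f_ext (BU 0%N).
- exact: extv_cokerS fg _ _ (AU n) (BU n.+1).
- exact: extv_coker_r tfg _ _ (CB n) (CA n.+1).
- have [b <-] := short_exact_surj fg d => gb0.
  have [|k kE] := short_exact_lift tfg (h := coe B b).
    by move=> c; rewrite -[LHS]coeval_nat -[coeval C (g b)]/(coe D (g b)) gb0.
  have [a aE] := A_surj k.
  suff /eqP : b - f a = 0 by rewrite subr_eq0 => /eqP ->; apply: short_exact_comp fg _.
  apply: B0; rewrite raddfB; apply: linear_ext => c.
  rewrite -[LHS]/(coeval C b c - coeval C (f a) c) coeval_nat.
  by rewrite -[coeval C a]/(coe A a) aE kE subrr.
- have [k kE] := ext1_lift tfg (CA 0%N) phi.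
  have [b bE] := B_surj k; exists (g b); apply: linear_ext => c.
  by rewrite [LHS]coeval_nat -[coeval C b]/(coe B b) bE kE.
Qed.

End Exact.

Lemma Auslander_retract : retract_closed (Auslander_class C).
Proof.
move=> M N [i [r ir]] /Auslander_classE[NU CN N0 N_surj].
have MN : retract M N by exists i, r.
have tir x : tensC r (tensC i x) = x.
  move: x; apply: (@tens_additive_ext _ _ _ _ (tens_map1 r C \o tens_map1 i C) idfun) => m c.
  by rewrite -[LHS]/(tens_map1 r C (tens_map1 i C (tensor m c))) !tens_map1E ir.
have TMN : retract (T M) (T N) by exists (tensC i), (tensC r).
apply/Auslander_classE; split=> [n|n|m m0|phi].
- exact: extv_retract_l MN (NU n).
- exact: extv_retract_r TMN (CN n).
- rewrite -(ir m) (N0 (i m)) ?linear0 //; apply: linear_ext => c.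
  by rewrite [LHS]coeval_nat -[coeval C m]/(coe M m) m0 linear0.
- have [n nE] := N_surj (tensC i \o phi); exists (r n); apply: linear_ext => c.
  by rewrite [LHS]coeval_nat -[coeval C n]/(coe N n) nE [LHS]tir.
Qed.

Lemma Auslander_thick : left_thick (Auslander_class C).
Proof.
split; first by move=> A B D f g fg; apply: Auslander_extension fg.
  exact/closed_summandsE/Auslander_retract.
by move=> A B D f g fg; apply: Auslander_kernel fg.
Qed.

Lemma Prod_charE M : Prod_char_class C M <-> exists I : Type, retract M ((I -> U) : lmodType R^c).
Proof. by split=> -[I MI]; exists I; apply/dsummandE. Qed.

Lemma Prod_retract : retract_closed (Prod_char_class C).
Proof.
move=> M N MN /Prod_charE[I NI]; apply/Prod_charE; exists I.
exact: retract_trans MN NI.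
Qed.

Lemma retract_power_prod (R' : pzRingType) (V : lmodType R') (I J : Type) :
  retract ((I -> V) * (J -> V))%type ((I + J -> V) : lmodType R').
Proof.
have a_lin : linear (fun (p : ((I -> V) * (J -> V))%type) (k : I + J) =>
    match k with inl i => p.1 i | inr j => p.2 j end).
  by move=> a x y; apply: funext => -[].
have b_lin : linear (fun p : I + J -> V => (p \o inl, p \o inr)) by [].
by exists (mk_linear a_lin), (mk_linear b_lin) => -[].
Qed.

Lemma Prod_prod A B : Prod_char_class C A -> Prod_char_class C B ->
  Prod_char_class C (A * B)%type.
Proof.
move=> /Prod_charE[I AI] /Prod_charE[J BJ]; apply/Prod_charE; exists (I + J)%type.
exact: retract_trans (retract_prod AI BJ) (retract_power_prod U I J).
Qed.

Lemma Prod_power I : Prod_char_class C (I -> U).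
Proof. by apply/Prod_charE; exists I; apply: retract_refl. Qed.

Lemma Auslander_perp_Prod n A B : Auslander_class C A -> Prod_char_class C B -> extv n A B.
Proof.
move=> /Auslander_classE[AU _ _ _] /Prod_charE[I BI].
by apply: extv_retract_r BI _; apply/extv_prod/AU.
Qed.

(** * Powers of the character module of C lie in the Auslander class *)

Section SelfCoSmall.
Hypotheses (C_cosmall : self_co_small C) (C_orth : prod_Tor_orthogonal C).

Section Power.
Variable I : Type.

Local Notation UI := ((I -> U) : lmodType R^c).
Local Notation SI := ((I -> charg {linear C -> C}) : lmodType (rend C)^c).

(** The two isomorphisms of self-co-smallness compose to (C^+)^I (x)_R C = (S^+)^I; what remains to
    be checked is S-linearity, on elementary tensors. *)
Lemma power_iso : exists (a : {linear T UI -> SI}) (b : {linear SI -> T UI}),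
  [/\ cancel a b, cancel b a & forall (phi : UI) c i (f : {linear C -> C}),
    ch (a (tensor phi c) i) f = ch (phi i) (f c)].
Proof.
have [prod_bij char_bij] := C_cosmall.
have prodB : zmod_morphism (@tens_prod R C I).
  apply: tens_lift_zmod; split=> [c p q|p c d|p r c]; apply: funext => i.
  - exact: tensorDl.
  - exact: tensorDr.
  - exact: tensorZ.
have charB : zmod_morphism (@tens_char R C).
  apply: tens_lift_zmod; split=> [c p q|p c d|p r c]; apply: additive_ext => f //.
    by rewrite /= /eval_char_fun linearD raddfD.
  by rewrite /= /eval_char_fun linearZZ.
pose a (x : T UI) : SI := fun i => tens_char (tens_prod x i).
have aB : zmod_morphism a by move=> x y; apply: funext => i; rewrite /a prodB [LHS]charB.
have aE (phi : UI) c i (f : {linear C -> C}) : ch (a (tensor phi c) i) f = ch (phi i) (f c).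
  by rewrite /a tens_prod_tensor tens_char_tensor.
have a_lin : linear a.
  have sB (L : lmodType (rend C)^c) s : zmod_morphism (fun z : L => s *: z).
    by move=> u v; rewrite scalerBr.
  move=> s x y; rewrite [LHS](raddfD (mk_additive aB)); congr (_ + _).
  move: x; apply: (@tens_additive_ext _ _ _ _ (mk_additive aB \o mk_additive (sB (T UI) s))
    (mk_additive (sB SI s) \o mk_additive aB)) => phi c.
  rewrite -[LHS]/(a (s *: (tensor phi c : T UI))) scale_tensor.
  rewrite -[RHS]/(s *: a (tensor phi c)); apply: funext => i; apply: additive_ext => f.
  by rewrite aE [RHS]aE.
have a_inj : injective a.
  move=> x y axy; apply: (bij_inj (prod_bij I)); apply: funext => i.
  by apply: (bij_inj char_bij); apply: (congr1 (fun F => F i) axy).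
have a_surj : surjective a.
  case: (prod_bij I) char_bij => p _ pK [q _ qK] F.
  by exists (p (q \o F)); apply: funext => i; rewrite /a pK /= qK.
have [|b bE] := linear_lift (f := mk_linear a_lin) (h := idfun) a_inj.
  by move=> F; apply: a_surj.
exists (mk_linear a_lin), b; split=> // x; apply: a_inj; exact: bE.
Qed.

(** Through [power_iso] this is Hom_S(C, (S^+)^I) = (C^+)^I by evaluation at the identity of C: the
    preimage of [h] is [c |-> a (h c) i idfun]. Ext over S vanishes because (S^+)^I is injective. *)
Lemma Auslander_power : Auslander_class C UI.
Proof.
have [a [b [aK bK aE]]] := power_iso.
apply/Auslander_classE; split=> [n|n|phi phi0|h].
- exact/Tor_vanishesE/C_orth.
- apply: injective_extv; apply: retract_injective (prod_injective (@charg_end_injective R C)).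
  by exists a, b.
- apply: funext => i; apply: additive_ext => c.
  rewrite -[c in LHS]/((idfun : {linear C -> C}) c) -aE.
  by rewrite -[tensor _ _]/(coe UI phi c) phi0 linear0.
- have psiB i : zmod_morphism (fun c : C => ch (a (h c) i) (idfun : {linear C -> C})).
    by move=> x y; rewrite !linearB.
  exists (fun i => mk_additive (psiB i) : charg C); apply: linear_ext => c.
  apply: (can_inj aK); apply: funext => i; apply: additive_ext => f.
  rewrite [LHS]aE /=.
  (* [f c] is the scalar multiple of [c] by [f] over S; linearity moves [f] out of [h] and [a], and
     the action on S^+ turns the value at the identity into the value at [f]. *)
  rewrite -[X in h X]/((f : (rend C)^c) *: (c : rmod C)) !linearZZ.
  rewrite -[LHS]/(ch (a (h c) i) (hom_act (f : rend C) (idfun : {linear C -> C}))).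
  by congr (ch (a (h c) i) _); apply: linear_ext.
Qed.

End Power.

Lemma Prod_Auslander : subclass (Prod_char_class C) (Auslander_class C).
Proof. by move=> M /Prod_charE[I MI]; apply: Auslander_retract MI (Auslander_power I). Qed.

(** If every [h : A -> C^+] kills [m], every character kills [m (x) c], so the coevaluation of [m]
    is zero and [m = 0]: evaluation [w] is injective. Each [h] extends along [w] to the projection
    of index [h], so [Auslander_coker] applies. *)
Lemma Auslander_cover A : Auslander_class C A ->
  exists B V, [/\ ses A V B, Prod_char_class C V & Auslander_class C B].
Proof.
move=> AA; have /Auslander_classE[_ _ A0 _] := AA.
have w_lin : linear (fun (m : A) (h : {linear A -> U}) => h m).
  by move=> r x y; apply: funext => h; rewrite linearP.
pose w := mk_linear w_lin.
have w_inj : injective w.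
  apply: linear_inj => m m0; apply: A0; apply: linear_ext => c.
  apply/eqP/negPn/negP => /char_neq0[chi]; have [h hE] := tens_hom_of chi.
  rewrite -[coe A m c]/(tensor m (c : C)) -hE.
  by have := congr1 (fun F : {linear A -> U} -> U => F h) m0; rewrite /= => ->; rewrite eqxx.
have wq := short_exact_coker w_inj.
exists (coker w), ({linear A -> U} -> U); split; first by exists w, (coker_proj w).
  exact: Prod_power.
apply: Auslander_coker wq _ AA (Auslander_power _) => h.
have e_lin : linear (fun F : {linear A -> U} -> U => F h) by [].
by exists (mk_linear e_lin).
Qed.

End SelfCoSmall.
End Auslander.

Theorem theorem5p3 (R : pzRingType) (C : lmodType R) :
  (self_small C -> sigma_self_orthogonal C ->
     right_weak_AB_context (Add_class C) (cores (Add_class C)) (Bass_class C) /\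
     forall N : lmodType R, cores (Bass_class C) N ->
       (exists (Y X : lmodType R) (f : {linear Y -> X}) (g : {linear X -> N}),
          [/\ short_exact f g, Bass_class C Y & cores (Add_class C) X]) /\
       (exists (Y X : lmodType R) (f : {linear N -> Y}) (g : {linear Y -> X}),
          [/\ short_exact f g, Bass_class C Y & cores (Add_class C) X])) /\
  (self_co_small C -> prod_Tor_orthogonal C ->
     left_weak_AB_context (Auslander_class C) (res (Prod_char_class C)) (Prod_char_class C) /\
     forall M : lmodType R^c, res (Auslander_class C) M ->
       (exists (Y X : lmodType R^c) (f : {linear Y -> X}) (g : {linear X -> M}),
          [/\ short_exact f g, Auslander_class C X & res (Prod_char_class C) Y]) /\
       (exists (Y X : lmodType R^c) (f : {linear M -> Y}) (g : {linear Y -> X}),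
          [/\ short_exact f g, Auslander_class C X & res (Prod_char_class C) Y])).
Proof.
split=> C_small C_orth.
- apply: right_context.
  + exact: Add_retract.
  + exact: Add_prod.
  + by exists (dsum unit C); apply: Add_dsum.
  + exact: Add_Bass.
  + exact: Bass_thick.
  + exact: Add_perp_Bass.
  + exact: Bass_cover.
- apply: left_context.
  + exact: Prod_retract.
  + exact: Prod_prod.
  + by exists (unit -> charg C); apply: Prod_power.
  + exact: Prod_Auslander.
  + exact: Auslander_thick.
  + exact: Auslander_perp_Prod.
  + exact: Auslander_cover.
Qed.
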